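(* For each $n\in\mathbb{N}$, consider a measure space $X_n$ along with a second countable locally compact abelian group $G_n$ that acts freely on $X_n$ by measure space isomorphisms and contains a discrete cyclic subgroup of order at least $n$. Suppose this action admits a measurable fundamental domain $\Omega_n\subseteq X_n$ with a nonzero $\sigma$-finite measure $\nu_n$ such that $L^2(\Omega_n,\nu_n)$ is separable and the mapping $G_n\times(\Omega_n,\nu_n)\to X_n$ given by $(g,\omega)\mapsto g\cdot\omega$ is a measure space isomorphism. Then \[ c_2\bigl(\ell^2(\mathbb{Z})/\mathbb{Z}\bigr)\leq\liminf_{n\to\infty}c_2\bigl(L^2(X_n)/G_n\bigr). \]
   Context: $L^2$ and $\ell^2$ spaces consist of complex-valued functions. $G_n$ carries Haar measure, and $G_n\times(\Omega_n,\nu_n)$ carries the product measure. A fundamental domain is a subset meeting every $G_n$-orbit in $X_n$ in exactly one point. The group $G_n$ acts unitarily on $L^2(X_n)$ by $(g\cdot f)(x)=f(g^{-1}\cdot x)$, and $\mathbb{Z}$ acts on $\ell^2(\mathbb{Z})$ by translation. For a group $G$ of unitaries on a Hilbert space $V$ with closed orbits, $V/G$ is the set of orbits $[x]=G\cdot x$ with metric $d([x],[y])=\inf_{g\in G}\|gx-y\|$; under the stated hypotheses all orbits in $L^2(X_n)$ and $\ell^2(\mathbb{Z})$ are closed, so these are metric spaces. The Euclidean distortion $c_2(X)\in[1,\infty]$ of a metric space $X$ is the infimum of all $c$ for which there exist a Hilbert space $H$, a map $f\colon X\to H$ and a constant $\alpha>0$ such that $\alpha\, d_X(x,x')\leq\|f(x)-f(x')\|\leq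 c\,\alpha\, d_X(x,x')$ for all $x,x'\in X$ (the infimum of the empty set being $\infty$). *)

(* Defs.v *)
From HB Require Import structures.
From mathcomp Require Import all_boot all_order all_algebra sesquilinear.
From mathcomp.real_closed Require Import complex.
From mathcomp Require Import all_classical all_reals all_analysis.
From mathcomp Require Import measurable_realfun.

Set Implicit Arguments.
Unset Strict Implicit.
Unset Printing Implicit Defensive.
Import Order.TTheory GRing.Theory Num.Theory.
Import numFieldNormedType.Exports ComplexField.

Local Open Scope classical_set_scope.
Local Open Scope ring_scope.

Section measure_iso.
Context d1 d2 (T1 : measurableType d1) (T2 : measurableType d2) (R : realType).

(* A bijection, measurable in both directions, carrying m1 to m2; it is not
   taken modulo null sets. *)
Definition measure_iso (m1 : set T1 -> \bar R) (m2 : set T2 -> \bar R)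
    (f : T1 -> T2) : Prop :=
  [/\ measurable_fun setT f,
      exists2 g : T2 -> T1, measurable_fun setT g & cancel f g /\ cancel g f
    & forall A : set T2, measurable A -> m1 (f @^-1` A) = m2 A].

End measure_iso.

(* Measurable types are pointed in the library, so a subset can only be made
   into a measurable space when it is known to be nonempty. *)
Record nonempty_set (T : Type) := NonemptySet {
  nonempty_set_set :> set T ;
  nonempty_setP : nonempty_set_set !=set0 }.

Section subset_space.
Context d (T : measurableType d) (A : nonempty_set T).

Definition subset_space : Type := set_type A.

HB.instance Definition _ := SubType.on subset_space.
HB.instance Definition _ := Choice.on subset_space.

Definition subset_space_point : subset_space :=
  SigSub (mem_set (projT2 (cid (nonempty_setP A)))).

HB.instance Definition _ := isPointed.Build subset_space subset_space_point.

Definition subset_incl : subset_space -> T := val.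

(* the trace of the sigma-algebra of T *)
HB.instance Definition _ :=
  Measurable.copy subset_space (g_sigma_algebra_preimageType subset_incl).

End subset_space.
Arguments subset_incl {d T A}.

HB.instance Definition _ := isPointed.Build int 0.
HB.instance Definition _ := @isMeasurable.Build default_measure_display
  int discrete_measurable discrete_measurable0
  discrete_measurableC discrete_measurableU.

Section borel.
Variable G : topologicalZmodType.

Definition borelType : Type := G.

HB.instance Definition _ := Choice.on borelType.
HB.instance Definition _ := isPointed.Build borelType (0 : G).
HB.instance Definition _ := @isMeasurable.Build (sigma_display (@open G))
  borelType <<s @open G >> (@sigma_algebra0 _ setT (@open G))
  (@sigma_algebraC borelType (@open G))
  (@sigma_algebra_bigcup _ setT (@open G)).

End borel.

Section groups.
Variable G : topologicalZmodType.

Definition lca_group : Prop :=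
  hausdorff_space G /\ locally_compact [set: G].

(* a nonzero translation-invariant Radon measure *)
Record haar_measure (R : realType)
    (m : {measure set (borelType G) -> \bar R}) : Prop := {
  haar_neq0 : m setT != 0%E ;
  haar_invariant : forall (g : G) (A : set (borelType G)), measurable A ->
    m [set g + x | x in (A : set G)] = m A ;
  haar_compact : forall K : set G, compact K -> (m K < +oo)%E ;
  haar_outer_regular : forall A : set (borelType G), measurable A ->
    m A = ereal_inf [set m U | U in [set U : set G | open U /\ A `<=` U]] ;
  haar_inner_regular : forall U : set G, open U ->
    m U = ereal_sup [set m K | K in [set K : set G | compact K /\ K `<=` U]] }.

Definition cyclic_subgroup (h : G) : set G := range (fun k : int => h *~ k).

Definition has_discrete_cyclic_subgroup (n : nat) : Prop :=
  exists h : G, let H := cyclic_subgroup h in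
    H `<=` isolated H /\ (`I_n #<= H)%card.

End groups.

(* The action laws are written additively because the groups are abelian. *)
Record iso_action (G : zmodType) d (X : measurableType d) (R : realType)
    (mu : {measure set X -> \bar R}) := IsoAction {
  iso_act :> G -> X -> X ;
  iso_act0 : forall x, iso_act 0 x = x ;
  iso_actD : forall g h x, iso_act (g + h) x = iso_act g (iso_act h x) ;
  iso_act_iso : forall g, measure_iso mu mu (iso_act g) }.

Section orbits.
Context {G : Type} {V : Type}.
Variable act : G -> V -> V.

Definition act_orbit (x : V) : set V := [set act g x | g in setT].

Definition act_free (e : G) : Prop := forall g x, act g x = x -> g = e.

Definition fundamental_domain (D : set V) : Prop :=
  forall x, exists! w, (D `&` act_orbit x) w.

Definition orbit_space : Type := set_type [set act_orbit x | x in setT].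

End orbits.

Section L2.
Context d (X : measurableType d) (R : realType).
Variable mu : {measure set X -> \bar R}.

Definition L2_norm (f : X -> R[i]) : \bar R :=
  'N[mu]_2%:E[EFin \o (@Normc.normc R \o f)].

Lemma L2_normE (f : X -> R[i]) :
  L2_norm f = ((\int[mu]_x (Normc.normc (f x) ^+ 2)%:E) `^ 2^-1)%E.
Proof.
rewrite /L2_norm unlock; apply: (congr1 (fun z => z `^ 2^-1)%E).
apply: eq_integral => x _.
rewrite [X in (X `^ _)%E]abse_EFin poweR_EFin powR_mulrn//; congr EFin.
by rewrite real_normK// num_real.
Qed.

Record L2fun := L2Fun {
  L2fun_val :> X -> R[i] ;
  L2fun_Re : measurable_fun setT (@complex.Re R \o L2fun_val) ;
  L2fun_Im : measurable_fun setT (@complex.Im R \o L2fun_val) ;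
  L2fun_fin : (L2_norm L2fun_val < +oo)%E }.

HB.instance Definition _ := gen_eqMixin L2fun.
HB.instance Definition _ := gen_choiceMixin L2fun.

Definition L2_eq (f g : L2fun) : bool := `[< {ae mu, forall x, f x = g x} >].

Let L2_eq_refl : reflexive L2_eq.
Proof. by move=> f; apply/asboolP; exact: aeW. Qed.

Let L2_eq_sym : symmetric L2_eq.
Proof.
by move=> f g; apply/asboolP/asboolP => h; apply: filterS h => x ->.
Qed.

Let L2_eq_trans : transitive L2_eq.
Proof.
move=> g f h /asboolP fg /asboolP gh; apply/asboolP.
by apply: filterS2 fg gh => x -> ->.
Qed.

Canonical L2_equiv := EquivRel L2_eq L2_eq_refl L2_eq_sym L2_eq_trans.

Local Open Scope quotient_scope.

Definition L2 : Type := {eq_quot L2_eq}.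

HB.instance Definition _ := Choice.on L2.
HB.instance Definition _ := EqQuotient.on L2.

Definition L2_dist (u v : L2) : R :=
  fine (L2_norm (fun x => repr u x - repr v x)).

Definition L2_separable : Prop :=
  exists2 S : set L2, countable S &
    forall (u : L2) (e : R), 0 < e -> exists2 v, S v & L2_dist u v < e.

End L2.

Section L2_action.
Context (G : zmodType) d (X : measurableType d) (R : realType).
Context (mu : {measure set X -> \bar R}) (a : iso_action G mu).

Let ma g : measurable_fun setT (a g).
Proof. by case: (iso_act_iso a g). Qed.

Lemma iso_action_ae g (P : X -> Prop) :
  {ae mu, forall x, P x} -> {ae mu, forall x, P (a g x)}.
Proof.
move=> [N [mN N0 PN]]; exists (a g @^-1` N); split.
- by rewrite -[X in measurable X]setTI; exact: ma.
- by have [_ _ ->] := iso_act_iso a g.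
- by move=> x Px; exact: PN.
Qed.

Lemma measurable_normc d' (Y : measurableType d') (f : Y -> R[i]) :
    measurable_fun setT (@complex.Re R \o f) ->
    measurable_fun setT (@complex.Im R \o f) ->
  measurable_fun setT (@Normc.normc R \o f).
Proof.
move=> mR mI.
rewrite (_ : _ \o f =
    fun y => Num.sqrt (complex.Re (f y) ^+ 2 + complex.Im (f y) ^+ 2)); last first.
  by apply/funext => y /=; case: (f y).
apply: (@measurableT_comp _ _ _ _ _ _ (@Num.sqrt R)).
  exact: continuous_measurable_fun (@sqrt_continuous R).
by apply: measurable_funD; exact: measurable_funX.
Qed.

Lemma L2_norm_act g (f : X -> R[i]) :
    measurable_fun setT (@complex.Re R \o f) ->
    measurable_fun setT (@complex.Im R \o f) ->
  L2_norm mu (f \o a g) = L2_norm mu f.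
Proof.
move=> mR mI; rewrite !L2_normE; apply: (congr1 (fun z => z `^ 2^-1)%E).
pose h x := ((Normc.normc (f x) ^+ 2)%:E)%E.
have mh : measurable_fun setT h.
  by apply/measurable_EFinP/measurable_funX; exact: measurable_normc.
rewrite -[RHS]/(\int[mu]_x h x)%E.
transitivity (\int[pushforward mu (a g)]_x h x)%E; last first.
  apply: eq_measure_integral => A mA _.
  by have [_ _] := iso_act_iso a g; exact.
by rewrite ge0_integral_pushforward// => x _; rewrite lee_fin sqr_ge0.
Qed.

Definition L2fun_act_subproof (g : G) (f : L2fun mu) :
  [/\ measurable_fun setT (@complex.Re R \o (f \o a (- g))),
      measurable_fun setT (@complex.Im R \o (f \o a (- g))) &
      (L2_norm mu (f \o a (- g)%R) < +oo)%E].
Proof.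
case: f => f mR mI ff /=; split.
- exact: (measurableT_comp mR (ma (- g))).
- exact: (measurableT_comp mI (ma (- g))).
- by rewrite L2_norm_act.
Qed.

Definition L2fun_act (g : G) (f : L2fun mu) : L2fun mu :=
  let: And3 mR mI ff := L2fun_act_subproof g f in
  @L2Fun _ _ _ mu (f \o a (- g)) mR mI ff.

Lemma L2fun_actE g f x : L2fun_act g f x = f (a (- g) x).
Proof. by rewrite /L2fun_act; case: L2fun_act_subproof. Qed.

Local Open Scope quotient_scope.

Definition L2_act (g : G) (u : L2 mu) : L2 mu :=
  \pi_(L2 mu) (L2fun_act g (repr u)).

Definition L2_orbit_space : Type := orbit_space L2_act.

(* The group acts by isometries, so that this is inf_g d(g u, v) for any u in
   the orbit A and any v in the orbit B, see L2_orbit_distE below. *)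
Definition L2_orbit_dist (A B : L2_orbit_space) : R :=
  inf [set L2_dist u v | u in (val A : set (L2 mu)) & v in (val B : set (L2 mu))].

Lemma L2_piP (f g : L2fun mu) :
  \pi_(L2 mu) f = \pi_(L2 mu) g <-> {ae mu, forall x, f x = g x}.
Proof.
split=> [/eqP|h]; first by rewrite eqmodE => /asboolP.
by apply/eqP; rewrite eqmodE; apply/asboolP.
Qed.

Lemma L2_reprP (f : L2fun mu) :
  {ae mu, forall x, (repr (\pi_(L2 mu) f) : L2fun mu) x = f x}.
Proof. by apply/L2_piP; rewrite reprK. Qed.

Lemma L2_act_pi g (f : L2fun mu) :
  L2_act g (\pi_(L2 mu) f) = \pi_(L2 mu) (L2fun_act g f).
Proof.
apply/L2_piP; have := iso_action_ae (- g) (L2_reprP f).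
by apply: filterS => x; rewrite !L2fun_actE.
Qed.

Lemma L2_act0 u : L2_act 0 u = u.
Proof.
rewrite -[u]reprK L2_act_pi; apply/L2_piP.
by apply: aeW => x; rewrite L2fun_actE oppr0 iso_act0.
Qed.

Lemma L2_actD g h u : L2_act (g + h) u = L2_act g (L2_act h u).
Proof.
rewrite -[u]reprK (L2_act_pi (g + h)) (L2_act_pi h) (L2_act_pi g); apply/L2_piP.
by apply: aeW => x; rewrite !L2fun_actE opprD addrC iso_actD.
Qed.

Lemma measurable_L2funB (f g : L2fun mu) :
  measurable_fun setT (@complex.Re R \o (fun x => f x - g x)) /\
  measurable_fun setT (@complex.Im R \o (fun x => f x - g x)).
Proof.
case: f g => f fR fI _ [g gR gI _] /=; split.
- rewrite (_ : _ \o _ = (@complex.Re R \o f) \- (@complex.Re R \o g)).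
    exact: measurable_funB.
  by apply/funext => x /=; case: (f x) => ? ?; case: (g x).
- rewrite (_ : _ \o _ = (@complex.Im R \o f) \- (@complex.Im R \o g)).
    exact: measurable_funB.
  by apply/funext => x /=; case: (f x) => ? ?; case: (g x).
Qed.

Lemma L2_dist_pi (f g : L2fun mu) :
  L2_dist (\pi_(L2 mu) f) (\pi_(L2 mu) g) =
  fine (L2_norm mu (fun x => f x - g x)).
Proof.
rewrite /L2_dist !L2_normE; apply: (congr1 (fun z => fine (z `^ 2^-1)%E)).
have mh (p q : L2fun mu) :
    measurable_fun setT (fun x => (Normc.normc (p x - q x) ^+ 2)%:E).
  apply/measurable_EFinP/measurable_funX.
  by have [] := measurable_L2funB p q; exact: measurable_normc.
apply: ae_eq_integral => //.
by apply: filterS2 (L2_reprP f) (L2_reprP g) => x /= fx gx _; rewrite fx gx.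
Qed.

Lemma L2_act_isometry g u v : L2_dist (L2_act g u) (L2_act g v) = L2_dist u v.
Proof.
rewrite -[u]reprK -[v]reprK !L2_act_pi !L2_dist_pi; congr fine.
have [mR mI] := measurable_L2funB (repr u) (repr v).
rewrite -(L2_norm_act (- g) mR mI); congr L2_norm.
by apply/funext => x; rewrite !L2fun_actE.
Qed.

Definition L2_orbit (u : L2 mu) : L2_orbit_space :=
  SigSub (mem_set (imageT (act_orbit L2_act) u)).

Lemma L2_orbit_distE u v :
  L2_orbit_dist (L2_orbit u) (L2_orbit v) =
  inf [set L2_dist (L2_act g u) v | g in setT].
Proof.
rewrite /L2_orbit_dist /=; congr inf; apply/seteqP; split => [r|_ [g _ <-]].
  move=> [_ [g _ <-]] [_ [h _ <-]] <-; exists (g - h) => //.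
  rewrite -(L2_act_isometry h (L2_act (g - h) u) v) -(L2_actD h (g - h) u).
  by rewrite addrCA subrr addr0.
exists (L2_act g u); first by exists g.
by exists v => //; exists 0 => //; exact: L2_act0.
Qed.

End L2_action.

Section distortion.
Context (R : realType).

(* Real Hilbert spaces suffice: a complex one is real by restriction of scalars,
   and a real one embeds isometrically in its complexification. *)
Definition is_hilbert (H : completeNormedModType R) : Prop :=
  exists ip : {dot H for idfun}, forall x, ip x x = `|x| ^+ 2.

(* The bound 1 <= c only matters for spaces with at most one point. *)
Definition euclidean_distortion (T : Type) (dist : T -> T -> R) : \bar R :=
  ereal_inf [set c%:E | c in [set c : R | 1 <= c /\
    exists (H : completeNormedModType R) (f : T -> H) (a : R),
      [/\ is_hilbert H, 0 < a &
        forall x y, a * dist x y <= `|f x - f y| <= c * a * dist x y]]].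

Definition L2_quotient_distortion (G : zmodType) d (X : measurableType d)
    (mu : {measure set X -> \bar R}) (a : iso_action G mu) : \bar R :=
  euclidean_distortion (@L2_orbit_dist G d X R mu a).

End distortion.

Section int_translation.
Context (R : realType).

Definition counting_int : {measure set int -> \bar R} := @counting int R.

Lemma int_translation_iso (k : int) :
  measure_iso counting_int counting_int (fun m : int => k + m).
Proof.
split=> //.
- exists (fun m => m - k) => //.
  by split=> m /=; [rewrite (addrC k m) addrK|rewrite (addrC k) subrK].
- move=> A _; rewrite /counting_int/= /counting.
  have -> : (fun m : int => k + m) @^-1` A = (fun m => m - k) @` A.
    apply/seteqP; split=> [m Am|_ [m Am <-]]; last by rewrite /= (addrC k) subrK.
    by exists (k + m) => //; rewrite (addrC k m) addrK.
  have BA : ((fun m => m - k) @` A #= A)%card.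
    by apply: inj_card_eq => x y _ _; exact: addIr.
  rewrite (eq_finite_set BA); case: asboolP => // /finite_setP[n An].
  by rewrite (card_fset_set An) (card_fset_set (card_eq_trans BA An)).
Qed.

(* L^2 of int with the counting measure is l^2(Z) *)
Definition int_translation : iso_action int counting_int :=
  @IsoAction int _ int R counting_int (fun k m => k + m)
    (@add0r int) (fun g h x => esym (addrA g h x)) int_translation_iso.

End int_translation.
Arguments int_translation : clear implicits.

(* Main.v *)
(* Let B in X_n be the image of U x A, where U is a small open neighbourhood of 0 in
   G_n and A in Omega_n has positive finite measure, and let h generate the cyclic
   subgroup.  A function f on Z supported in [-k, k] is sent to the normalized step
   function sum_i f(i) 1_(h^i B).  The inner product of g F_1 with F_2 is
   sum_(i,j) f_1(i) f_2(j)^* rho(g h^(i-j)) with rho(g) = mu(gB /\ B) / mu(B); if U is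
   small and n > 4k + 2, at most one power of h contributes for each g, so that the
   distance between the orbits depends on f_1 and f_2 only, through their
   cross-correlation.  The same computation on Z itself (B = {0}) shows that it equals
   their distance in l^2(Z)/Z.
   Given embeddings of the L^2(X_n)/G_n of distortion < c for infinitely many n, the
   truncations of a point of l^2(Z)/Z to [-k, k] thus yield a sequence of points in
   Hilbert spaces, and an ultraproduct of these Hilbert spaces receives an embedding of
   l^2(Z)/Z of distortion at most c. *)
Require Import Defs.
From HB Require Import structures.
From mathcomp Require Import all_boot all_order all_algebra sesquilinear.
From mathcomp.real_closed Require Import complex.
From mathcomp Require Import all_classical all_reals all_analysis.
From mathcomp Require Import measurable_realfun.
From mathcomp Require Import ring lra zify.

Set Implicit Arguments.
Unset Strict Implicit.
Unset Printing Implicit Defensive.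
Import Order.TTheory GRing.Theory Num.Theory.
Import numFieldNormedType.Exports.

Local Open Scope classical_set_scope.
Local Open Scope ring_scope.

(** * Ultraproducts of Hilbert spaces *)

(** [F] decides every preimage g^-1(A). If it contained the complement for some A in a proper filter
    [K] finer than the image, then A and its complement would both lie in [K]. *)
Lemma fmap_ultra (S T : Type) (F : set_system S) (g : S -> T) :
  UltraFilter F -> UltraFilter (g @ F).
Proof.
move=> FU; split=> [|K KF sFK]; first exact: fmap_proper_filter.
apply/seteqP; split=> // A KA.
have [//|FnA] := in_ultra_setVsetC (g @^-1` A) FU.
have KnA : K (~` A) by exact: sFK.
by have /filter_ex[x []] : K (A `&` ~` A) by exact: filterI.
Qed.

(** Compactness of [-M, M] in its ultrafilter form: the image of [F] is an ultrafilter containing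
    this segment. *)
Lemma ultra_is_cvg (R : realType) (S : Type) (F : set_system S) (g : S -> R) :
  UltraFilter F -> (exists M, forall n, `|g n| <= M) -> cvg (g @ F).
Proof.
move=> FU [M gM].
have := @segment_compact R (- M) M; rewrite compact_ultra.
have gMM : (g @ F) `[- M, M]%classic.
  apply: (@filterE _ F) => n /=; have := gM n.
  by rewrite in_itv/= -ler_norml; exact.
by move=> /(_ _ (fmap_ultra g FU) gMM)[l [_ gl]]; apply/cvg_ex; exists l.
Qed.

Section bounded_families.
Context (R : realType) (H : nat -> normedModType R).

Record bounded_family := BoundedFamily {
  bounded_family_val :> forall n, H n ;
  bounded_familyP : exists M, forall n, `|bounded_family_val n| <= M }.

HB.instance Definition _ := gen_eqMixin bounded_family.
HB.instance Definition _ := gen_choiceMixin bounded_family.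

Implicit Types f g : bounded_family.

Fact bounded_add_subproof f g : exists M, forall n, `|f n + g n| <= M.
Proof.
have [M fM] := bounded_familyP f; have [N gN] := bounded_familyP g.
by exists (M + N) => n; rewrite (le_trans (ler_normD _ _)) ?lerD.
Qed.

Fact bounded_scale_subproof (a : R) f : exists M, forall n, `|a *: f n| <= M.
Proof.
have [M fM] := bounded_familyP f.
by exists (`|a| * M) => n; rewrite normrZ ler_wpM2l ?fM.
Qed.

Fact bounded_zero_subproof : exists M : R, forall n, `|0 : H n| <= M.
Proof. by exists 0 => n; rewrite normr0. Qed.

Definition bounded_add f g := BoundedFamily (bounded_add_subproof f g).
Definition bounded_scale a f := BoundedFamily (bounded_scale_subproof a f).
Definition bounded_zero := BoundedFamily bounded_zero_subproof.

End bounded_families.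

Section ultraproduct.
Context (R : realType) (H : nat -> normedModType R).
Context (U : set_system nat) (UU : UltraFilter U).

Implicit Types f g : bounded_family H.

Definition ultra_eq f g : bool := `[< `|f n - g n| @[n --> U] --> (0 : R) >].

Let ultra_eq_refl : reflexive ultra_eq.
Proof.
move=> f; apply/asboolP; rewrite (_ : (fun _ => _) = cst 0); first exact: cvg_cst.
by apply/funext => n; rewrite subrr normr0.
Qed.

Let ultra_eq_sym : symmetric ultra_eq.
Proof.
move=> f g; rewrite /ultra_eq.
by rewrite (_ : (fun n => `|f n - g n|) = (fun n => `|g n - f n|))//;
  apply/funext => n; rewrite distrC.
Qed.

Let ultra_eq_trans : transitive ultra_eq.
Proof.
move=> g f h /asboolP fg /asboolP gh; apply/asboolP.
apply: (@squeeze_cvgr _ _ _ _ (cst 0) (fun n => `|f n - g n| + `|g n - h n|)).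
- by apply: filterE => n; rewrite normr_ge0 ler_distD.
- exact: cvg_cst.
- by rewrite -[0]addr0; exact: cvgD.
Qed.

Canonical ultra_equiv := EquivRel ultra_eq ultra_eq_refl ultra_eq_sym ultra_eq_trans.

Local Open Scope quotient_scope.

Definition ultraproduct : Type := {eq_quot ultra_eq}.

HB.instance Definition _ := Choice.on ultraproduct.
HB.instance Definition _ := EqQuotient.on ultraproduct.

Implicit Types u v w : ultraproduct.

Local Notation pi := (\pi_ultraproduct).

Lemma ultra_piP f g : pi f = pi g <-> `|f n - g n| @[n --> U] --> (0 : R).
Proof.
split=> [/eqP|h]; first by rewrite eqmodE => /asboolP.
by apply/eqP; rewrite eqmodE; apply/asboolP.
Qed.

Lemma ultra_reprP f :
  `|(repr (pi f) : bounded_family H) n - f n| @[n --> U] --> (0 : R).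
Proof. by apply/ultra_piP; rewrite reprK. Qed.

Definition ultra_norm u : R := lim (`|repr u n| @[n --> U]).
Definition ultra_add u v := pi (bounded_add (repr u) (repr v)).
Definition ultra_scale (a : R) u := pi (bounded_scale a (repr u)).
Definition ultra_zero := pi (bounded_zero H).
Definition ultra_opp := ultra_scale (- 1).

(** [ultra_norm] is computed on the chosen representative. Any other one differs from it by a family
    whose norm tends to 0, so its norms are squeezed to the same limit. *)
Lemma ultra_norm_cvg f : `|f n| @[n --> U] --> ultra_norm (pi f).
Proof.
have : cvg (`|(repr (pi f) : bounded_family H) n| @[n --> U]).
  apply: ultra_is_cvg; have [M fM] := bounded_familyP (repr (pi f)).
  by exists M => n; rewrite normr_id.
rewrite -/(ultra_norm (pi f)) => h.
rewrite -[ultra_norm _]subr0.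
have := ultra_reprP f => h0.
apply: (@squeeze_cvgr _ _ _ _
  (fun n => `|(repr (pi f) : bounded_family H) n| -
            `|(repr (pi f) : bounded_family H) n - f n|)
  (fun n => `|(repr (pi f) : bounded_family H) n| +
            `|(repr (pi f) : bounded_family H) n - f n|)).
- apply: filterE => n; set a := bounded_family_val _ n.
  rewrite lerBlDr -{1}(subrK (f n) a) addrC ler_normD/= -lerBlDl.
  by rewrite (le_trans (ler_norm _))// ?(distrC a) (le_trans (ler_dist_dist _ _)).
- exact: cvgB.
- by rewrite subr0 -[X in _ --> X]addr0; exact: cvgD.
Qed.

Lemma ultra_add_pi f g : ultra_add (pi f) (pi g) = pi (bounded_add f g).
Proof.
apply/ultra_piP => /=.
apply: (@squeeze_cvgr _ _ _ _ (cst 0)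
  (fun n => `|(repr (pi f) : bounded_family H) n - f n| +
            `|(repr (pi g) : bounded_family H) n - g n|)).
- by apply: filterE => n; rewrite normr_ge0/= opprD addrACA ler_normD.
- exact: cvg_cst.
- by rewrite -[0]addr0; apply: cvgD; exact: ultra_reprP.
Qed.

Lemma ultra_scale_pi a f : ultra_scale a (pi f) = pi (bounded_scale a f).
Proof.
apply/ultra_piP => /=; rewrite -[0](mulr0 `|a|).
under eq_fun do rewrite -scalerBr normrZ.
by apply: cvgM; [exact: cvg_cst|exact: ultra_reprP].
Qed.

(** Reduces the module axioms of the quotient to those of each factor. *)
Lemma ultra_pi_ext f g : (forall n, f n = g n) -> pi f = pi g.
Proof.
move=> fg; apply/ultra_piP; rewrite (_ : (fun _ => _) = cst 0); first exact: cvg_cst.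
by apply/funext => n; rewrite fg subrr normr0.
Qed.

Let addA : associative ultra_add.
Proof.
elim/quotW=> f; elim/quotW=> g; elim/quotW=> h.
rewrite (ultra_add_pi g h) (ultra_add_pi f g) !ultra_add_pi.
by apply: ultra_pi_ext => n /=; rewrite addrA.
Qed.

Let addC : commutative ultra_add.
Proof.
elim/quotW=> f; elim/quotW=> g; rewrite !ultra_add_pi.
by apply: ultra_pi_ext => n /=; rewrite addrC.
Qed.

Let add0 : left_id ultra_zero ultra_add.
Proof.
elim/quotW=> f; rewrite ultra_add_pi.
by apply: ultra_pi_ext => n /=; rewrite add0r.
Qed.

Let addN : left_inverse ultra_zero ultra_opp ultra_add.
Proof.
elim/quotW=> f; rewrite /ultra_opp (ultra_scale_pi _ f) ultra_add_pi.
by apply: ultra_pi_ext => n /=; rewrite scaleN1r addNr.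
Qed.

HB.instance Definition _ := GRing.isZmodule.Build ultraproduct addA addC add0 addN.

Let scaleA a b u : ultra_scale a (ultra_scale b u) = ultra_scale (a * b) u.
Proof.
elim/quotW: u => f; rewrite (ultra_scale_pi b f) !ultra_scale_pi.
by apply: ultra_pi_ext => n /=; rewrite scalerA.
Qed.

Let scale1 : left_id 1 ultra_scale.
Proof.
elim/quotW=> f; rewrite !ultra_scale_pi.
by apply: ultra_pi_ext => n /=; rewrite scale1r.
Qed.

Let scaleDr : right_distributive ultra_scale +%R.
Proof.
move=> a; elim/quotW=> f; elim/quotW=> g.
rewrite [_ + _]ultra_add_pi (ultra_scale_pi a f) (ultra_scale_pi a g).
rewrite ultra_scale_pi [RHS]ultra_add_pi.
by apply: ultra_pi_ext => n /=; rewrite scalerDr.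
Qed.

Let scaleDl u : {morph ultra_scale^~ u : a b / a + b}.
Proof.
move=> a b; elim/quotW: u => f.
rewrite (ultra_scale_pi a f) (ultra_scale_pi b f) ultra_scale_pi [RHS]ultra_add_pi.
by apply: ultra_pi_ext => n /=; rewrite scalerDl.
Qed.

HB.instance Definition _ :=
  GRing.Zmodule_isLmodule.Build R ultraproduct scaleA scale1 scaleDr scaleDl.

Let normD u v : ultra_norm (u + v) <= ultra_norm u + ultra_norm v.
Proof.
elim/quotW: u => f; elim/quotW: v => g; rewrite [_ + _]ultra_add_pi.
apply: (ler_cvg_to (@ultra_norm_cvg _)
  (cvgD (@ultra_norm_cvg f) (@ultra_norm_cvg g))).
by apply: filterE => n; rewrite ler_normD.
Qed.

Let normZ a u : ultra_norm (a *: u) = `|a| * ultra_norm u.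
Proof.
elim/quotW: u => f; rewrite [_ *: _]ultra_scale_pi.
apply: (cvg_unique _ (@ultra_norm_cvg _)) => //=.
under eq_fun do rewrite normrZ.
by apply: cvgM; [exact: cvg_cst|exact: ultra_norm_cvg].
Qed.

Let norm0_eq0 u : ultra_norm u = 0 -> u = 0.
Proof.
elim/quotW: u => f u0; apply/ultra_piP => /=.
by under eq_fun do rewrite subr0; rewrite -u0; exact: ultra_norm_cvg.
Qed.

HB.instance Definition _ :=
  Lmodule_isNormed.Build R ultraproduct normD normZ norm0_eq0.

Lemma ultra_addE f g : pi f + pi g = pi (bounded_add f g).
Proof. exact: ultra_add_pi. Qed.

Lemma ultra_scaleE a f : a *: pi f = pi (bounded_scale a f).
Proof. exact: ultra_scale_pi. Qed.

Lemma ultra_subE f g : pi f - pi g = pi (bounded_add f (bounded_scale (-1) g)).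
Proof. by rewrite -scaleN1r ultra_scaleE ultra_addE. Qed.

Lemma ultra_normE f : `|f n| @[n --> U] --> `|pi f|.
Proof. exact: ultra_norm_cvg. Qed.

Lemma ultra_distE f g : `|f n - g n| @[n --> U] --> `|pi f - pi g|.
Proof.
rewrite ultra_subE; have := @ultra_normE (bounded_add f (bounded_scale (-1) g)).
by under eq_fun do rewrite /= scaleN1r.
Qed.


Section complete.
(* This makes the ultrafilter nonprincipal, and saturation then gives completeness
   whether or not the factors are complete. *)
Hypothesis Uoo : \oo `<=` U.

Let e (k : nat) : R := 2^-1 ^+ k.

Let e_gt0 k : 0 < e k. Proof. by rewrite exprn_gt0// invr_gt0. Qed.

(** Telescoping: as [e] halves at each step, 2 e_i = 4 e_i - 4 e_(i+1). *)
Let sum_e k n : (k <= n)%N -> \sum_(k <= i < n) 2 * e i = 4 * e k - 4 * e n.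
Proof.
elim: n => [|n IH].
  by rewrite leqn0 => /eqP ->; rewrite big_geq// subrr.
rewrite leq_eqVlt => /predU1P[->|]; first by rewrite big_geq// subrr.
rewrite ltnS => kn; rewrite big_nat_recr//= IH// /e exprS; lra.
Qed.

Lemma ultra_complete (F : set_system (ultraproduct)) :
  ProperFilter F -> cauchy F -> cvg F.
Proof.
move=> FF /cauchyP Fc.
have [x xF] := boolp.choice (fun k => Fc (e k) (e_gt0 k)).
(* The balls of radii [e k.+1] and [e k] both belong to [F], hence meet. *)
have xx k : `|x k.+1 - x k| < 2 * e k.
  have [y [/=]] := filter_ex (filterI (xF k.+1) (xF k)).
  rewrite -!ball_normE /=.
  have := ler_distD y (x k.+1) (x k); rewrite (distrC y) => h yk1 yk.
  have : e k.+1 <= e k by rewrite /e exprS ler_piMl ?exprn_ge0//; lra.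
  lra.
pose f k := repr (x k).
have xE k : x k = pi (f k) by rewrite reprK.
(* The increments of the representatives are cut off where they are too large,
   which happens almost nowhere, and the limit is obtained by summing the n first
   increments in the n-th factor. *)
pose d i n := if `|f i.+1 n - f i n| <= 2 * e i then f i.+1 n - f i n else 0.
have de i n : `|d i n| <= 2 * e i.
  by rewrite /d; case: ifPn => // _; rewrite normr0 mulr_ge0// ltW.
have sumd k n : (k <= n)%N -> `|\sum_(k <= i < n) d i n| <= 4 * e k.
  move=> kn; rewrite (le_trans (ler_norm_sum _ _ _))//.
  apply: (@le_trans _ _ (\sum_(k <= i < n) 2 * e i)); first exact: ler_sum.
  by rewrite sum_e// gerBl mulr_ge0// ltW.
have gP : exists M, forall n, `|f 0%N n + \sum_(0 <= i < n) d i n| <= M.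
  have [M fM] := bounded_familyP (f 0%N); exists (M + 4 * e 0%N) => n.
  by rewrite (le_trans (ler_normD _ _))// lerD// sumd.
pose g := BoundedFamily gP.
(* The norm of the i-th increment tends along [U] to the distance of [x i.+1] and [x i], which is
   below [2 * e i]; thus the cut-off is inactive on a set of [U], for each of finitely many
   increments. *)
have telescope k : \forall n \near U, \sum_(0 <= i < k) d i n = f k n - f 0%N n.
  elim: k => [|k IH]; first by apply: filterE => n; rewrite big_geq// subrr.
  have : \forall n \near U, `|f k.+1 n - f k n| < 2 * e k.
    have := @ultra_distE (f k.+1) (f k); rewrite -!xE => h.
    by apply: (cvgr_lt _ h); exact: xx.
  apply: filterS2 IH => n IH dn.
  by rewrite big_nat_recr//= IH /d ifT ?(ltW dn)// addrC addrA subrK.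
(* For n >= k the sum defining [g] splits at k: its first part leads from [f 0] to [f k], and its
   tail is at most [4 * e k]. *)
have xg k : `|x k - pi g| <= 4 * e k.
  rewrite xE; apply: (cvgr_to_le (@ultra_distE (f k) g)).
  have kU : \forall n \near U, (k <= n)%N by apply: Uoo; exact: nbhs_infty_ge.
  apply: filterS2 kU (telescope k) => n kn tn /=.
  rewrite (big_cat_nat _ (n := k))//= tn addrA [f 0%N n + _]addrC subrK.
  by rewrite opprD addrA subrr add0r normrN sumd.
apply/cvg_ex; exists (pi g); apply/cvgrPdist_lt => r r0.
(* 5 = 4 + 1: the distance from the limit to the centre [x k], plus the radius of the ball around
   it. *)
have [k kr] : exists k, 5 * e k < r.
  have := @cvg_geometric R 5 2^-1; rewrite ger0_norm ?invr_ge0// invf_lt1// ltr1n.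
  move=> /(_ erefl) /cvgr_lt /(_ _ r0)[k _ kP]; exists k.
  by have := kP k (leqnn k).
apply: filterS (xF k) => y; rewrite -ball_normE/= => xy.
have h := ler_distD (x k) (pi g) y.
apply: (le_lt_trans h); apply: lt_trans kr.
have -> : 5 * e k = 4 * e k + e k.
  by rewrite -[X in _ + X]mul1r -mulrDl; congr (_ * _); lra.
by rewrite ler_ltD// distrC.
Qed.

Definition ultraproduct_complete : completeNormedModType R :=
  HB.pack ultraproduct (Uniform_isComplete.Build ultraproduct ultra_complete).

End complete.

Section inner_product.
Variable ip : forall n, {dot (H n) for idfun}.
Hypothesis ipE : forall n x, ip n x x = `|x| ^+ 2.

(** Polarization of the norm, so that no choice of representatives enters. [ultra_ip_cvg] identifies
    it with the limit of the inner products of the factors, from which bilinearity follows. *)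
Definition ultra_ip u v : R := (`|u + v| ^+ 2 - `|u| ^+ 2 - `|v| ^+ 2) / 2.

Let polar n (x y : H n) : ip n x y = (`|x + y| ^+ 2 - `|x| ^+ 2 - `|y| ^+ 2) / 2.
Proof.
have Dl (a b c : H n) : ip n (a + b) c = ip n a c + ip n b c by exact: linearDl.
have Dr (a b c : H n) : ip n c (a + b) = ip n c a + ip n c b by exact: linearDr.
have C : ip n y x = ip n x y by rewrite [LHS]hermC/= expr0 mul1r.
by rewrite -!ipE Dl !Dr C; lra.
Qed.

Lemma ultra_ip_cvg f g : ip n (f n) (g n) @[n --> U] --> ultra_ip (pi f) (pi g).
Proof.
under eq_fun do rewrite polar.
rewrite /ultra_ip ultra_addE.
apply: cvgM; last exact: cvg_cst.
by apply: cvgB; first apply: cvgB; rewrite exprS expr1;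
  under eq_fun do rewrite exprS expr1; apply: cvgM; exact: ultra_normE.
Qed.

Let ultra_ipP : bilinear_for ( *%R : GRing.Scale.law _ _)
  (idfun \; *%R : GRing.Scale.law _ _) ultra_ip.
Proof.
split=> [w a u v|w a u v] /=.
- elim/quotW: u => f; elim/quotW: v => g; elim/quotW: w => h.
  rewrite ultra_scaleE ultra_addE.
  apply: (cvg_unique _ (@ultra_ip_cvg _ _)) => //=.
  under eq_fun do rewrite linearDl linearZl_LR.
  by apply: cvgD; [apply: cvgM; [exact: cvg_cst|]|]; exact: ultra_ip_cvg.
- elim/quotW: u => f; elim/quotW: v => g; elim/quotW: w => h.
  rewrite ultra_scaleE ultra_addE.
  apply: (cvg_unique _ (@ultra_ip_cvg _ _)) => //=.
  under eq_fun do rewrite linearDr linearZr_LR.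
  by apply: cvgD; [apply: cvgM; [exact: cvg_cst|]|]; exact: ultra_ip_cvg.
Qed.

HB.instance Definition _ := bilinear_isBilinear.Build R ultraproduct ultraproduct R
  ( *%R : GRing.Scale.law _ _) (idfun \; *%R : GRing.Scale.law _ _) ultra_ip ultra_ipP.

Let ultra_ip_sym u v : ultra_ip u v = (-1) ^+ false * idfun (ultra_ip v u).
Proof. by rewrite /ultra_ip expr0 mul1r/= (addrC u) addrAC. Qed.

HB.instance Definition _ := isHermitianSesquilinear.Build R ultraproduct false idfun
  ultra_ip ultra_ip_sym.

Lemma ultra_ipE u : ultra_ip u u = `|u| ^+ 2.
Proof.
by rewrite /ultra_ip -mulr2n normrMn -[_ *+ 2]mulr_natl exprMn; lra.
Qed.

Let ultra_ip_gt0 u : u != 0 -> 0 < ultra_ip u u.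
Proof. by rewrite ultra_ipE => u0; rewrite exprn_gt0// normr_gt0. Qed.

HB.instance Definition _ := isDotProduct.Build R ultraproduct ultra_ip ultra_ip_gt0.

Lemma ultra_dot : exists d : {dot ultraproduct for idfun}, forall u, d u u = `|u| ^+ 2.
Proof. by exists ultra_ip; exact: ultra_ipE. Qed.

End inner_product.

End ultraproduct.

(* Rescaled and centred at x0, the embeddings of the Y k have a limit with values in
   the ultraproduct of their targets. *)
Lemma distortion_limit (R : realType) (T : Type) (dist : T -> T -> R) (c : R)
    (Y : nat -> Type) (dY : forall k, Y k -> Y k -> R) (Phi : forall k, T -> Y k)
    (x0 : T) : 1 <= c ->
  (forall k, exists (H : completeNormedModType R) (f : Y k -> H) (a : R),
      [/\ is_hilbert H, 0 < a &
        forall x y, a * dY k x y <= `|f x - f y| <= c * a * dY k x y]) ->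
  (forall x y, dY k (Phi k x) (Phi k y) @[k --> \oo] --> dist x y) ->
  (euclidean_distortion dist <= c%:E)%E.
Proof.
move=> c1 emb lim.
have [H0 H0P] := boolp.choice emb.
pose f k := projT1 (cid (H0P k)).
pose a k := projT1 (cid (projT2 (cid (H0P k)))).
have P k : [/\ is_hilbert (H0 k), 0 < a k & forall x y,
    a k * dY k x y <= `|f k x - f k y| <= c * a k * dY k x y].
  exact: projT2 (cid (projT2 (cid (H0P k)))).
have hilb k : is_hilbert (H0 k) by have [] := P k.
pose ip0 k := projT1 (cid (hilb k)).
have ipE0 k : forall x, ip0 k x x = `|x| ^+ 2 by exact: projT2 (cid (hilb k)).
(* Refining [\oo] serves twice: it makes the ultraproduct complete and keeps the limits given by
   [lim]. *)
have [U [UU Uoo]] := ultraFilterLemma eventually_filter.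
pose F k x : H0 k := (a k)^-1 *: (f k (Phi k x) - f k (Phi k x0)).
have distF k x y : `|F k x - F k y| = (a k)^-1 * `|f k (Phi k x) - f k (Phi k y)|.
  have [_ a0 _] := P k.
  rewrite -scalerBr normrZ gtr0_norm ?invr_gt0//; congr (_ * `|_|).
  by rewrite opprB addrA subrK.
have Fle k x y : `|F k x - F k y| <= c * dY k (Phi k x) (Phi k y).
  have [_ a0 fP] := P k; rewrite distF ler_pdivrMl// mulrCA mulrA.
  by have /andP[] := fP (Phi k x) (Phi k y).
have Fge k x y : dY k (Phi k x) (Phi k y) <= `|F k x - F k y|.
  have [_ a0 fP] := P k; rewrite distF ler_pdivlMl//.
  by have /andP[] := fP (Phi k x) (Phi k y).
(* Since [F k x0] is 0, the norm of [F k x] is at most c times a convergent sequence of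
   distances. *)
have Fbnd x : exists M, forall k, `|F k x| <= M.
  have /cvg_seq_bounded/pinfty_ex_gt0[M M0 dM] :
      cvgn (fun k => dY k (Phi k x) (Phi k x0)) by apply/cvg_ex; eexists; exact: lim.
  exists (c * M) => k.
  have -> : F k x = F k x - F k x0 by rewrite [X in _ - X]/F subrr scaler0 subr0.
  apply: (le_trans (Fle k x x0)); rewrite ler_wpM2l//; first by rewrite (le_trans _ c1).
  exact: le_trans (ler_norm _) (dM k I).
pose H1 k : normedModType R := H0 k.
pose g x : bounded_family H1 := @BoundedFamily R H1 (fun k => F k x) (Fbnd x).
apply: ereal_inf_lbound; exists c => //; split=> //.
exists (@ultraproduct_complete R H1 U UU Uoo),
  (fun x => \pi_(@ultraproduct R H1 U UU)%qT (g x)), 1.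
split=> //; first by exact: (@ultra_dot R H1 U UU ip0 ipE0).
move=> x y; rewrite mul1r mulr1.
have limU : dY k (Phi k x) (Phi k y) @[k --> U] --> dist x y.
  by apply: cvg_trans (lim x y); exact: cvg_app.
apply/andP; split.
  apply: (ler_cvg_to limU (@ultra_distE _ _ _ UU (g x) (g y))).
  by apply: filterE => k; exact: Fge.
apply: (ler_cvg_to (@ultra_distE _ _ _ UU (g x) (g y)) (cvgM (cvg_cst c) limU)).
by apply: filterE => k; exact: Fle.
Qed.

(** * Orbit distances between sums of translates *)

Section correlation.
Context (R : realType) (G : zmodType) (h : G) (m : nat).
Variables (rho : G -> R) (S : R) (c : 'I_m -> 'I_m -> R).
Hypotheses (rho_ge0 : forall g, 0 <= rho g) (rho_le1 : forall g, rho g <= 1).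
Hypothesis rho0 : rho 0 = 1.
Hypothesis rho_sep : forall g (s t : int), `|s| <= m%:Z -> `|t| <= m%:Z ->
  rho (g + h *~ s) != 0 -> rho (g + h *~ t) != 0 -> s = t.

(** For [c i j] equal to [redot (f1 i) (f2 j)], this is the real part of the cross-correlation of f1
    and f2 at lag s. *)
Definition correlation (s : int) : R :=
  \sum_(i < m) \sum_(j < m) c i j * (i%:Z - j%:Z == s)%:R.

(** In the application, [S] is the sum of the two squared norms, [rho g] the normalized overlap of
    gB with B, and [V g] the squared distance after moving by g. *)
Let V g := S - 2 * \sum_(i < m) \sum_(j < m) c i j * rho (g + h *~ (i%:Z - j%:Z)).

Let ij_lt (i j : 'I_m) : `|i%:Z - j%:Z| < m%:Z.
Proof. by have := ltn_ord i; have := ltn_ord j; lia. Qed.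

Let corr_out (s : int) : m%:Z <= `|s| -> correlation s = 0.
Proof.
move=> ms; rewrite /correlation big1// => i _; rewrite big1// => j _.
by case: eqP => [e|_]; rewrite ?mulr0//; have := ij_lt i j; rewrite e; lia.
Qed.

(** All lags i - j have absolute value below m, so [rho_sep] kills every term with i - j different
    from s. *)
Let V_single g (s : int) : `|s| <= m%:Z -> rho (g + h *~ s) != 0 ->
  V g = S - 2 * rho (g + h *~ s) * correlation s.
Proof.
move=> sm gs; rewrite /V /correlation -mulrA; congr (_ - 2 * _).
rewrite mulr_sumr; apply: eq_bigr => i _; rewrite mulr_sumr; apply: eq_bigr => j _.
case: eqP => [->|ne]; first by rewrite mulr1 mulrC.
rewrite !mulr0; have [->|nz] := eqVneq (rho (g + h *~ (i%:Z - j%:Z))) 0.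
  by rewrite mulr0.
by case: ne; apply: rho_sep nz gs => //; exact/ltW.
Qed.

(* By rho_sep, at most one rho (g + h *~ s) with |s| <= m is nonzero, so that V g is
   a convex combination of S - 2 * correlation s and S = S - 2 * correlation m. *)
Lemma inf_correlation :
  inf [set Num.sqrt (V g) | g in setT] =
  inf [set Num.sqrt (S - 2 * correlation s) | s in setT].
Proof.
have lb0 (T : Type) (f : T -> R) : has_lbound [set Num.sqrt (f t) | t in setT].
  by exists 0 => _ [t _ <-]; exact: sqrtr_ge0.
(* Moving by [h *~ (- s)] brings lag s to 0, where [rho] is 1. If |s| > m, the correlation is 0, and
   lag m, whose correlation also vanishes, takes its place. *)
have Vs s : exists g, V g = S - 2 * correlation s.
  have [sm|sm] := lerP `|s| m%:Z; last first.
    exists (h *~ (- m%:Z)); rewrite (corr_out (ltW sm)) (@V_single _ m%:Z)//.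
      by rewrite corr_out ?mulr0//; lia.
    by rewrite -mulrzDr addNr mulr0z rho0 oner_neq0.
  exists (h *~ (- s)); rewrite (@V_single _ s)// -mulrzDr addNr mulr0z rho0 ?oner_neq0//.
  by rewrite mulr1.
apply/eqP; rewrite eq_le; apply/andP; split.
  apply: lb_le_inf; first by exists (Num.sqrt (S - 2 * correlation 0)), 0.
  move=> _ [s _ <-]; have [g <-] := Vs s.
  by apply: ge_inf; [exact: lb0|exists g].
apply: lb_le_inf; first by exists (Num.sqrt (V 0)), 0.
move=> _ [g _ <-].
suff [s sV] : exists s, S - 2 * correlation s <= V g.
  apply: (@le_trans _ _ (Num.sqrt (S - 2 * correlation s))); last exact: ler_wsqrtr.
  by apply: ge_inf; [exact: lb0|exists s].
have [[s [sm gs]]|none] :=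
  pselect (exists s : int, `|s| <= m%:Z /\ rho (g + h *~ s) != 0).
  (* A nonnegative correlation lowers the distance most at full weight, as [rho] is at most 1; a
     negative one only raises it, so lag m with correlation 0 does better. *)
  have [A0|A0] := leP 0 (correlation s).
    exists s; rewrite (V_single sm gs) lerD2l lerN2 -mulrA ler_wpM2l//.
    by rewrite ler_piMl.
  exists m%:Z; rewrite corr_out ?mulr0 ?subr0 ?(V_single sm gs); last by lia.
  by rewrite lerDl oppr_ge0 mulr_ge0_le0 ?mulr_ge0// ltW.
exists m%:Z; rewrite corr_out ?mulr0 ?subr0; last by lia.
rewrite /V big1 ?mulr0 ?subr0// => i _; rewrite big1// => j _.
have [->|nz] := eqVneq (rho (g + h *~ (i%:Z - j%:Z))) 0; first by rewrite mulr0.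
by case: none; exists (i%:Z - j%:Z); split=> //; exact/ltW.
Qed.

End correlation.

(** * Step functions and their L2 distances *)

Section complex_dot.
Context (R : realType).
Implicit Types z w : R[i].

(** The real part of z times the conjugate of w. *)
Definition redot z w : R :=
  complex.Re z * complex.Re w + complex.Im z * complex.Im w.

Lemma normc_subE z w :
  Normc.normc (z - w) ^+ 2 = redot z z + redot w w - 2 * redot z w.
Proof.
case: z w => [a b] [c d]; rewrite /redot /=.
by rewrite sqr_sqrtr ?addr_ge0 ?sqr_ge0//; ring.
Qed.

End complex_dot.

Section real_step.
Context d (X : measurableType d) (R : realType) (mu : {measure set X -> \bar R}).
Context (I : finType).

Lemma integrable_indic_fin (A : set X) : measurable A -> (mu A < +oo)%E ->
  mu.-integrable setT (fun x => (\1_A x)%:E).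
Proof.
move=> mA fA; apply/integrableP; split.
  by apply/measurable_EFinP; exact: measurable_indic.
rewrite (eq_integral (fun x => (\1_A x)%:E)); last first.
  by move=> t _; rewrite gee0_abs// lee_fin.
by rewrite integral_indic// setIT.
Qed.

Implicit Types (E F : I -> set X) (c e : I -> R).

Definition real_step E c (x : X) : R := \sum_i c i * \1_(E i) x.

Lemma measurable_real_step E c : (forall i, measurable (E i)) ->
  measurable_fun setT (real_step E c).
Proof.
move=> mE; apply: measurable_sum => i.
by apply: measurable_funM; [exact: measurable_cst|exact: measurable_indic].
Qed.

Lemma real_step_mul E F c e x : real_step E c x * real_step F e x =
  \sum_(p : I * I) c p.1 * e p.2 * \1_(E p.1 `&` F p.2) x.
Proof.
rewrite /real_step mulr_suml -(pair_big predT predT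
  (fun i j => c i * e j * \1_(E i `&` F j) x))/=.
apply: eq_bigr => i _; rewrite mulr_sumr; apply: eq_bigr => j _.
by rewrite indicI /=; ring.
Qed.

Lemma real_step_integral E F c e :
  (forall i, measurable (E i)) -> (forall i, measurable (F i)) ->
  (forall i, (mu (E i) < +oo)%E) ->
  mu.-integrable setT (fun x => (real_step E c x * real_step F e x)%:E) /\
  (\int[mu]_x (real_step E c x * real_step F e x)%:E =
   (\sum_i \sum_j c i * e j * fine (mu (E i `&` F j)))%:E)%E.
Proof.
move=> mE mF fE.
have mEF i j : measurable (E i `&` F j) by exact: measurableI.
have fEF i j : (mu (E i `&` F j) < +oo)%E.
  by apply: le_lt_trans (fE i); apply: le_measure; rewrite ?inE//; exact: subIsetl.
have iEF (p : I * I) : mu.-integrable setT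
    (fun x => (c p.1 * e p.2)%:E * (\1_(E p.1 `&` F p.2) x)%:E)%E.
  by apply: integrableZl => //; exact: integrable_indic_fin.
have -> : (fun x => (real_step E c x * real_step F e x)%:E) =
    (fun x => \sum_(p : I * I) (c p.1 * e p.2)%:E * (\1_(E p.1 `&` F p.2) x)%:E)%E.
  apply/funext => x; rewrite real_step_mul -sumEFin.
  by apply: eq_bigr => p _; rewrite EFinM.
split; first exact: integrable_sum.
rewrite integral_sum// (pair_big predT predT)/= -sumEFin.
apply: eq_bigr => -[i j] _ /=.
rewrite integralZl//; last exact: integrable_indic_fin.
by rewrite integral_indic// setIT [in RHS]EFinM fineK// ge0_fin_numE.
Qed.

End real_step.

Section step.
Context d (X : measurableType d) (R : realType) (mu : {measure set X -> \bar R}).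
Context (I : finType).
Implicit Types (E F : I -> set X) (c e : I -> R[i]).

(** Real and imaginary parts are kept apart so that measurability and integrals reduce to those of
    [real_step]. *)
Definition step E c (x : X) : R[i] :=
  (real_step E (fun i => complex.Re (c i)) x +i*
   real_step E (fun i => complex.Im (c i)) x)%C.

Lemma step_integral E F c e :
  (forall i, measurable (E i)) -> (forall i, measurable (F i)) ->
  (forall i, (mu (E i) < +oo)%E) ->
  mu.-integrable setT (fun x => (redot (step E c x) (step F e x))%:E) /\
  (\int[mu]_x (redot (step E c x) (step F e x))%:E =
   (\sum_i \sum_j redot (c i) (e j) * fine (mu (E i `&` F j)))%:E)%E.
Proof.
move=> mE mF fE.
have [i1 e1] := real_step_integral (fun i => complex.Re (c i))
  (fun i => complex.Re (e i)) mE mF fE.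
have [i2 e2] := real_step_integral (fun i => complex.Im (c i))
  (fun i => complex.Im (e i)) mE mF fE.
split; first by apply: eq_integrable (integrableD measurableT i1 i2).
under eq_integral do rewrite EFinD.
rewrite integralD// e1 e2 -EFinD -big_split; congr EFin; apply: eq_bigr => i _.
by rewrite -big_split; apply: eq_bigr => j _ /=; rewrite -mulrDl.
Qed.

Lemma step_dist_integral E F c e :
  (forall i, measurable (E i)) -> (forall i, measurable (F i)) ->
  (forall i, (mu (E i) < +oo)%E) -> (forall i, (mu (F i) < +oo)%E) ->
  (\int[mu]_x (Normc.normc (step E c x - step F e x) ^+ 2)%:E =
   (\sum_i \sum_j redot (c i) (c j) * fine (mu (E i `&` E j)) +
    \sum_i \sum_j redot (e i) (e j) * fine (mu (F i `&` F j)) -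
    2 * \sum_i \sum_j redot (c i) (e j) * fine (mu (E i `&` F j)))%:E)%E.
Proof.
move=> mE mF fE fF.
have [i1 e1] := step_integral c c mE mE fE.
have [i2 e2] := step_integral e e mF mF fF.
have [i3 e3] := step_integral c e mE mF fE.
under eq_integral do rewrite normc_subE EFinB EFinD EFinM.
rewrite integralB//; last 2 first.
- exact: integrableD.
- exact: integrableZl.
by rewrite integralD// integralZl// e1 e2 e3.
Qed.

Lemma step_fin E c : (forall i, measurable (E i)) -> (forall i, (mu (E i) < +oo)%E) ->
  (L2_norm mu (step E c) < +oo)%E.
Proof.
move=> mE fE; rewrite L2_normE.
(* The norm is the distance to the step function with zero coefficients, which the preceding formula
   shows to be finite. *)
have : (\int[mu]_x (Normc.normc (step E c x - step E (fun=> 0) x) ^+ 2)%:E < +oo)%E.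
  by rewrite step_dist_integral// ltry.
rewrite (eq_integral (fun x => (Normc.normc (step E c x) ^+ 2)%:E)).
  by move=> ?; rewrite poweR_lty.
move=> x _; congr ((Normc.normc _ ^+ 2)%:E).
rewrite (_ : step E (fun=> 0) x = 0) ?subr0// /step /real_step.
by congr Complex; rewrite big1// => i _; rewrite /= mul0r.
Qed.

Definition step_fun E c (mE : forall i, measurable (E i))
    (fE : forall i, (mu (E i) < +oo)%E) : L2fun mu :=
  @L2Fun _ _ _ mu (step E c)
    (measurable_real_step (fun i => complex.Re (c i)) mE)
    (measurable_real_step (fun i => complex.Im (c i)) mE) (step_fin c mE fE).

End step.

(** * Sums of translates of one set under a group action *)

Section translates.
Local Open Scope quotient_scope.
Context (R : realType) (G : zmodType) d (X : measurableType d).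
Context (mu : {measure set X -> \bar R}) (a : iso_action G mu).
Context (h : G) (B : set X).
Hypotheses (mB : measurable B) (B_gt0 : (0 < mu B)%E) (B_fin : (mu B < +oo)%E).

(** For each g, at most one lag in [-m, m] gives an overlap. Translates are written as preimages,
    the form in which [measure_iso] provides their measure. *)
Definition separated_translates (m : nat) :=
  forall g (s t : int), `|s| <= m%:Z -> `|t| <= m%:Z ->
  a (g + h *~ s) @^-1` B `&` B !=set0 -> a (g + h *~ t) @^-1` B `&` B !=set0 -> s = t.

Let measurable_act g A : measurable A -> measurable (a g @^-1` A).
Proof.
move=> mA; rewrite -[X in measurable X]setTI.
by case: (iso_act_iso a g) => + _ _; exact.
Qed.

Let act_measure g A : measurable A -> mu (a g @^-1` A) = mu A.
Proof. by move=> mA; case: (iso_act_iso a g) => _ _; exact. Qed.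

(** This is h^(i-k) B; the shift by k lets the indices 0, ..., 2k stand for the positions -k, ...,
    k. *)
Definition translate (k : nat) (i : int) := a (- (h *~ (i - k%:Z))) @^-1` B.

Lemma measurable_translate k i : measurable (translate k i).
Proof. exact: measurable_act. Qed.

Lemma translate_fin k i : (mu (translate k i) < +oo)%E.
Proof. by rewrite act_measure. Qed.

Variables (m k : nat) (sep : separated_translates m).

(** The factor mu(B)^(-1/2) gives the indicator of each translate norm 1. *)
Definition translate_sum (f : 'I_m -> R[i]) : L2fun mu :=
  step_fun (fun i => (Num.sqrt (fine (mu B)))^-1%:C%C * f i)
    (fun i : 'I_m => measurable_translate k i)
    (fun i : 'I_m => translate_fin k i).

Let rho g : R := fine (mu (a (- g) @^-1` B `&` B)) / fine (mu B).

Let fB_gt0 : 0 < fine (mu B).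
Proof. by rewrite fine_gt0// B_gt0. Qed.

Let mI g : measurable (a g @^-1` B `&` B).
Proof. by apply: measurableI => //; exact: measurable_act. Qed.

Let mI_fin g : mu (a g @^-1` B `&` B) \is a fin_num.
Proof.
rewrite ge0_fin_numE//; apply: le_lt_trans B_fin.
by apply: le_measure; rewrite ?inE//; exact: subIsetr.
Qed.

Let rho_ge0 g : 0 <= rho g.
Proof. by rewrite divr_ge0 ?fine_ge0//; exact: measure_ge0. Qed.

Let rho_le1 g : rho g <= 1.
Proof.
rewrite ler_pdivrMr// mul1r fine_le//; first by rewrite ge0_fin_numE.
by apply: le_measure; rewrite ?inE//; exact: subIsetr.
Qed.

Let rho0 : rho 0 = 1.
Proof.
rewrite /rho oppr0 (_ : a 0 @^-1` B = B) ?setIid ?divff ?gt_eqF//.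
by apply/seteqP; split=> x /=; rewrite iso_act0.
Qed.

Let rho_neq0 g : rho g != 0 -> a (- g) @^-1` B `&` B !=set0.
Proof.
move=> r0; apply/set0P; apply: contra r0 => /eqP B0.
by rewrite /rho B0 measure0 mul0r.
Qed.

Let rho_sep g (s t : int) : `|s| <= m%:Z -> `|t| <= m%:Z ->
  rho (g + h *~ s) != 0 -> rho (g + h *~ t) != 0 -> s = t.
Proof.
(* [rho] uses the preimage under the inverse, so separation is applied to -g, -s and -t. *)
move=> sm tm /rho_neq0 gs /rho_neq0 gt; apply: oppr_inj.
apply: (@sep (- g)); rewrite ?normrN// mulrNz -opprD//.
Qed.

(** By invariance of [mu], moving by h^(j-k) carries the overlap of g h^(i-j) B and B to that of g
    h^(i-k) B and h^(j-k) B. *)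
Let rho_translate g (i j : int) :
  fine (mu (a (- g) @^-1` translate k i `&` translate k j)) =
  fine (mu B) * rho (g + h *~ (i - j)).
Proof.
rewrite /rho mulrC divfK ?gt_eqF//; congr fine.
rewrite -(act_measure (- (h *~ (j - k%:Z))) (mI _)).
congr (mu _); apply/seteqP; split => x /=; rewrite /translate/=;
  rewrite -!iso_actD -!opprD -addrA -mulrzDr (_ : i - j + (j - k%:Z) = i - k%:Z);
  by rewrite ?(addrC (h *~ _)) ?addrA ?subrK//; lia.
Qed.

Let redot_scale (r : R) (z w : R[i]) :
  redot (r%:C%C * z) (r%:C%C * w) = r ^+ 2 * redot z w.
Proof. by case: z w => [x y] [x' y']; rewrite /redot/=; ring. Qed.

Let s := (Num.sqrt (fine (mu B)))^-1.

Let s2 : s ^+ 2 * fine (mu B) = 1.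
Proof. by rewrite exprVn sqr_sqrtr ?ltW// mulVf// gt_eqF. Qed.

(** Separation at g = 0 compares lag i - j with lag 0: distinct translates have null overlap, and
    the normalized indicators are orthonormal. *)
Let diag (f : 'I_m -> R[i]) :
  \sum_i \sum_j redot (s%:C%C * f i) (s%:C%C * f j) *
    fine (mu (translate k i%:Z `&` translate k j%:Z)) =
  \sum_i redot (f i) (f i).
Proof.
apply: eq_bigr => i _; rewrite (bigD1 i)//= big1 ?addr0 => [|j ji].
  rewrite setIid act_measure// redot_scale mulrAC s2 mul1r//.
have := rho_translate 0 i%:Z j%:Z.
rewrite (_ : a (- 0) @^-1` _ = translate k i%:Z); last first.
  by apply/seteqP; split=> x /=; rewrite oppr0 iso_act0.
move=> ->; have [->|nz] := eqVneq (rho (0 + h *~ (i%:Z - j%:Z))) 0.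
  by rewrite !mulr0.
have lt_i := ltn_ord i; have lt_j := ltn_ord j.
suff ij0 : i%:Z - j%:Z = 0.
  by case/eqP: ji; apply/val_inj => /=; lia.
apply: (@rho_sep 0) => //; first by lia.
by rewrite mulr0z addr0 rho0 oner_neq0.
Qed.

Lemma L2_dist_translate_sum g f1 f2 :
  L2_dist (L2_act a g (\pi_(L2 mu) (translate_sum f1)))
    (\pi_(L2 mu) (translate_sum f2)) =
  Num.sqrt (\sum_i redot (f1 i) (f1 i) + \sum_i redot (f2 i) (f2 i) -
    2 * \sum_(i < m) \sum_(j < m) redot (f1 i) (f2 j) * rho (g + h *~ (i%:Z - j%:Z))).
Proof.
rewrite L2_act_pi L2_dist_pi L2_normE.
pose E1 (i : 'I_m) := a (- g) @^-1` translate k i%:Z.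
pose E2 (i : 'I_m) := translate k i%:Z.
have mE1 i : measurable (E1 i) by apply: measurable_act; exact: measurable_translate.
have mE2 i : measurable (E2 i) by exact: measurable_translate.
have fE1 i : (mu (E1 i) < +oo)%E.
  by rewrite act_measure ?translate_fin//; exact: measurable_translate.
have fE2 i : (mu (E2 i) < +oo)%E by exact: translate_fin.
pose c (f : 'I_m -> R[i]) i := s%:C%C * f i.
set N := (\int[mu]_x _)%E.
have NE : N = (\int[mu]_x (Normc.normc (step E1 (c f1) x - step E2 (c f2) x) ^+ 2)%:E)%E.
  by apply: eq_integral => x _; rewrite L2fun_actE.
have N0 : (0 <= N)%E by apply: integral_ge0 => x _; rewrite lee_fin sqr_ge0.
move: NE N0; rewrite (step_dist_integral (c f1) (c f2) mE1 mE2 fE1 fE2) => ->.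
rewrite lee_fin => N0; rewrite poweR_EFin/= powR12_sqrt//; congr Num.sqrt.
congr (_ + _ - 2 * _).
- rewrite -[RHS]diag; apply: eq_bigr => i _; apply: eq_bigr => j _.
  rewrite -preimage_setI act_measure//.
  by apply: measurableI; exact: measurable_translate.
- exact: diag.
- apply: eq_bigr => i _; apply: eq_bigr => j _.
  by rewrite rho_translate redot_scale mulrACA s2 mul1r.
Qed.

(** The right-hand side mentions neither the action nor B nor [mu], which allows orbit distances in
    different spaces to be compared. *)
Lemma L2_orbit_dist_translate_sum f1 f2 :
  L2_orbit_dist (L2_orbit a (\pi_(L2 mu) (translate_sum f1)))
    (L2_orbit a (\pi_(L2 mu) (translate_sum f2))) =
  inf [set Num.sqrt (\sum_i redot (f1 i) (f1 i) + \sum_i redot (f2 i) (f2 i) -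
    2 * correlation (fun i j => redot (f1 i) (f2 j)) t) | t in setT].
Proof.
rewrite L2_orbit_distE -(@inf_correlation R G h m rho)//.
congr inf; apply/seteqP; split=> [_ [g _ <-]|_ [g _ <-]];
  by exists g => //; rewrite L2_dist_translate_sum.
Qed.

End translates.

(** * Separated translates in a locally compact group *)

(** If h had order dividing k, reduction modulo k would cover the subgroup by |k| < n multiples of
    h. *)
Lemma cyclic_order (G : topologicalZmodType) (h : G) (n : nat) (k : int) :
  (`I_n #<= cyclic_subgroup h)%card -> k != 0 -> `|k| < n%:Z -> h *~ k != 0.
Proof.
move=> nH k0 kn; apply/negP => /eqP hk.
have : (`I_n #<= `I_(`|k|%N))%card.
  apply: card_le_trans nH _.
  apply: card_le_trans (card_image_le (fun i : nat => h *+ i) _).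
  apply: subset_card_le => _ [z _ <-]; exists `|(z %% k)%Z|%N.
    by have := modz_ge0 z k0; have := ltz_mod z k0; rewrite /=; lia.
  rewrite -[h *+ _]/(h *~ (`|(z %% k)%Z|%N)%:Z) gez0_abs ?modz_ge0//.
  have -> : h *~ z = h *~ (k * (z %/ k)%Z) + h *~ (z %% k)%Z.
    by rewrite -[RHS]mulrzDr mulrC -divz_eq.
  by rewrite mulrzA hk mul0rz add0r.
by rewrite card_le_II; lia.
Qed.

Section group_nbhs.
Variable G : topologicalZmodType.

Lemma nbhs0_sub (W : set G) : nbhs 0 W ->
  exists2 V, nbhs (0 : G) V & forall x y, V x -> V y -> W (x - y).
Proof.
move=> W0; have := @sub_continuous G (0, 0) W; rewrite /= subrr => /(_ W0).
move=> [[A B] /= [A0 B0] AB]; exists (A `&` B); first exact: filterI.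
by move=> x y [Ax _] [_ By]; exact: (AB (x, y)).
Qed.

Lemma open_translate (x : G) (U : set G) : open U -> open [set x + y | y in U].
Proof.
move=> oU; rewrite openE => _ [u Uu <-].
apply: filterS (_ : nbhs (x + u) [set y | U (y - x)]) => [y Uyx|].
  by exists (y - x) => //; rewrite addrCA subrr addr0.
have := @sub_continuous G (x + u, x) U; rewrite /= addrAC subrr add0r.
move=> /(_ (open_nbhs_nbhs (conj oU Uu)))[[V W] /= [xV xW] VWU].
by apply: filterS xV => y Vy; apply: (VWU (y, x)); split=> //; exact: nbhs_singleton.
Qed.

(** The multiples to be avoided are finitely many, nonzero by [cyclic_order], and closed as points
    of a Hausdorff space. The index i below 4m + 1 encodes the exponent i - 2m. *)
Lemma nbhs0_avoid (h : G) (n m : nat) : hausdorff_space G ->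
  (`I_n #<= cyclic_subgroup h)%card -> (m.*2 < n)%N ->
  nbhs (0 : G) [set x | forall k : int, `|k| <= (m.*2)%:Z -> x = h *~ k -> k = 0].
Proof.
move=> hG nH mn.
have : \forall x \near (0 : G), forall i : 'I_(m.*2.*2.+1),
    i%:Z - (m.*2)%:Z != 0 -> x != h *~ (i%:Z - (m.*2)%:Z).
  apply: filter_forall => i.
  have [->|i0] := eqVneq (i%:Z - (m.*2)%:Z) 0; first exact: filterE.
  have hi : h *~ (i%:Z - (m.*2)%:Z) != 0.
    by apply: (cyclic_order nH i0); have := ltn_ord i; lia.
  have oC : open (~` [set h *~ (i%:Z - (m.*2)%:Z)]).
    exact/closed_openC/accessible_closed_set1/hausdorff_accessible.
  apply: filterS (open_nbhs_nbhs (conj oC _)) => [x xh _|].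
    exact/eqP.
  by move=> /= /esym/eqP; exact/negP.
apply: filterS => x xP k km xk.
pose i0 := absz (k + (m.*2)%:Z); have kl : (i0 < m.*2.*2.+1)%N by rewrite /i0; lia.
have := xP (Ordinal kl) => /=; have [//|k0] := eqVneq k 0.
have -> : i0%:Z - (m.*2)%:Z = k by rewrite /i0; lia.
by move=> /(_ k0); rewrite xk eqxx.
Qed.

(** If U were null, each x would have a basic neighbourhood inside x + U, null by invariance;
    countably many such sets would cover G and make [m] zero. *)
Lemma haar_open_gt0 (R : realType) (m : {measure set (borelType G) -> \bar R})
    (U : set G) : @second_countable G -> haar_measure m -> open U -> U 0 ->
  (0 < m U)%E.
Proof.
move=> [B cB [Bo Bb]] hm oU U0; rewrite lt0e measure_ge0 andbT.
have mO (V : set G) : open V -> measurable (V : set (borelType G)).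
  move=> oV; exact: (@sub_sigma_algebra G setT open V oV).
apply: contraNneq (haar_neq0 hm) => mU0.
move/countable_injP : cB => [f finj].
(* The injective numbering [f] leaves at most one null basic set in each [F n]. *)
pose F n : set (borelType G) := \bigcup_(b in [set b | [/\ B b, f b = n & m b = 0%E]]) b.
have F0 n : m.-negligible (F n).
  have [[b [Bb0 fb mb]]|none] := pselect (exists b, [/\ B b, f b = n & m b = 0%E]).
    exists b; split; [exact: (mO _ (Bo _ Bb0))|exact: mb|].
    move=> x [b' [Bb' fb' mb'] b'x].
    by rewrite (_ : b = b')//; apply: finj; rewrite ?inE// fb fb'.
  exists set0; split; [exact: measurable0|by rewrite measure0|].
  by move=> x [b' Pb' _]; case: none; exists b'.
have := negligible_bigcup F0; rewrite (_ : \bigcup_k F k = setT); last first.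
  apply/seteqP; split=> // x _.
  have xU : nbhs (x : G) [set x + y | y in U].
    by apply: open_nbhs_nbhs; split; [exact: open_translate|exists 0; rewrite ?addr0].
  have [b [/= Bb0 bx] bU] := Bb x _ xU.
  exists (f b) => //; exists b => //; split => //.
  apply/eqP; rewrite eq_le measure_ge0 andbT -mU0 -(haar_invariant hm x (mO _ oU)).
  apply: le_measure => //; rewrite inE; first exact: (mO _ (Bo _ Bb0)).
  exact: (mO _ (open_translate x oU)).
by move=> /negligibleP -> //; exact: measurableT.
Qed.

End group_nbhs.

Lemma sigma_finite_set_gt0 d (T : measurableType d) (R : realType)
    (nu : {sigma_finite_measure set T -> \bar R}) : nu setT != 0%E ->
  exists A, [/\ measurable A, (0 < nu A)%E & (nu A < +oo)%E].
Proof.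
move=> nu0; have [F FT Ffin] := sigma_finiteT nu.
have [[i Fi]|none] := pselect (exists i, nu (F i) != 0%E).
  exists (F i); have [mF fF] := Ffin i; split => //.
  by rewrite lt0e Fi measure_ge0.
case/eqP: nu0; apply/negligibleP => //; rewrite FT; apply: negligible_bigcup => i.
apply/negligibleP; first by have [] := Ffin i.
by apply: contrapT => Fi; apply: none; exists i; exact/eqP.
Qed.

(** In the product coordinates G acts by addition on the first factor. If both g h^s and g h^t carry
    some point of B into B, then both lie in V - V, and h^(s-t) lies in a neighbourhood of 0 free of
    nontrivial powers up to 2m. *)
Lemma exists_separated (R : realType) d (X : measurableType d)
    (mu : {measure set X -> \bar R}) (G : topologicalZmodType)
    (haar : {measure set (borelType G) -> \bar R}) (act : iso_action G mu)
    (Omega : nonempty_set X)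
    (nu : {sigma_finite_measure set (subset_space Omega) -> \bar R}) (n m : nat) :
  lca_group G -> @second_countable G -> haar_measure haar ->
  has_discrete_cyclic_subgroup G n -> nu setT != 0%E ->
  measure_iso (haar \x nu)%E mu
    (fun p : borelType G * subset_space Omega => act p.1 (subset_incl p.2)) ->
  (m.*2 < n)%N ->
  exists h B, [/\ measurable B, (0 < mu B)%E, (mu B < +oo)%E &
    separated_translates act h B m].
Proof.
move=> [hG lG] sG hP [h [_ nH]] nu0 [mp [q mq [pK qK]] pmu] mn.
have [A [mA A0 Afin]] := sigma_finite_set_gt0 nu0.
have [W' W'0 W'W] := nbhs0_sub (nbhs0_avoid hG nH mn).
have [V V0 VW'] := nbhs0_sub W'0.
(* Intersecting with a compact neighbourhood gives U, hence B, finite measure. *)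
have [K K0 [cK clK]] := lG (0 : G) I.
pose U : set G := interior (V `&` K).
have K0' : nbhs (0 : G) K.
  by apply: filterS (K0 : nbhs (0 : G) [set x | setT x -> K x]) => x; exact.
have U0 : U 0 by exact: filterI.
have oU : open U by exact: open_interior.
have UVK : U `<=` V `&` K by exact: interior_subset.
have mO (O : set G) : open O -> measurable (O : set (borelType G)).
  by move=> oO; exact: (@sub_sigma_algebra G setT open O oO).
have mU := mO _ oU.
have mK : measurable (K : set (borelType G)).
  by rewrite -[K]setCK; apply: measurableC; apply: mO; exact: closed_openC.
have mUA : measurable ((U : set (borelType G)) `*` A) by exact: measurableX.
pose B := q @^-1` ((U : set (borelType G)) `*` A).
have mB : measurable B by rewrite -[B]setTI; exact: mq.
have muB : mu B = (haar U * nu A)%E.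
  rewrite -(pmu _ mB) -product_measure1E//; congr ((_ \x _)%E _).
  by apply/seteqP; split=> x; rewrite /B /= pK.
have Ugt0 := haar_open_gt0 sG hP oU U0.
have Ufin : (haar U < +oo)%E.
  apply: le_lt_trans (haar_compact hP cK).
  by apply: le_measure; rewrite ?inE// => x /UVK[].
exists h, B; rewrite muB; split => //.
- by rewrite mule_gt0.
- by rewrite lte_mul_pinfty// ?measure_ge0// ge0_fin_numE.
move=> g s t sm tm.
have key r : act (g + h *~ r) @^-1` B `&` B !=set0 ->
    exists u u', [/\ V u, V u' & g + h *~ r = u' - u].
  move=> [x [/= [/= Ux _] [/= Uqx _]]].
  exists (q x).1, (q (act (g + h *~ r) x)).1; split.
  - by have [] := UVK _ Uqx.
  - by have [] := UVK _ Ux.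
  (* Acting adds [g + h *~ r] to the first coordinate, which is therefore recovered as a difference
     of first coordinates. *)
  have -> : act (g + h *~ r) x =
      (fun p : borelType G * subset_space Omega => act p.1 (subset_incl p.2))
      ((g + h *~ r + (q x).1 : borelType G), (q x).2).
    rewrite /= [RHS]iso_actD; congr (act _ _); exact: (esym (qK x)).
  by rewrite pK /= addrK.
move=> /key[u [u' [Vu Vu' gs]]] /key[v [v' [Vv Vv' gt]]].
apply/eqP; rewrite -subr_eq0; apply/eqP.
have := W'W _ _ (VW' _ _ Vu' Vu) (VW' _ _ Vv' Vv); rewrite -gs -gt; apply; first by lia.
by rewrite opprD addrACA subrr add0r mulrzBr.
Qed.

(** * The metric of L2 *)

Section L2_metric.
Context d (X : measurableType d) (R : realType) (mu : {measure set X -> \bar R}).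
Implicit Types (f g k : L2fun mu) (u v w : L2 mu).

Let Lnorm2E (p : X -> R) :
  ('N[mu]_2%:E[EFin \o p] = (\int[mu]_x (p x ^+ 2)%:E) `^ 2^-1)%E.
Proof.
rewrite unlock; apply: (congr1 (fun z => z `^ 2^-1)%E); apply: eq_integral => x _.
rewrite [X in (X `^ _)%E]abse_EFin poweR_EFin powR_mulrn//; congr EFin.
by rewrite real_normK// num_real.
Qed.

Let measurable_normc_sub f g :
  measurable_fun setT (fun x => Normc.normc (f x - g x)).
Proof. by have [] := measurable_L2funB f g; exact: measurable_normc. Qed.

Let normc_ge0 (z : R[i]) : 0 <= Normc.normc z.
Proof. by case: z => x y; exact: sqrtr_ge0. Qed.

Let normc_opp (z : R[i]) : Normc.normc (- z) = Normc.normc z.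
Proof. exact: (@normcN R z). Qed.

Let normc_triangle (z w : R[i]) :
  Normc.normc (z + w) <= Normc.normc z + Normc.normc w.
Proof. exact: (@le_normcD R z w). Qed.

Let normc_subC (z w : R[i]) : Normc.normc (z - w) = Normc.normc (w - z).
Proof. by rewrite -opprB normc_opp. Qed.

(** Minkowski's inequality combined with monotonicity. Applied to moduli, it yields both the
    triangle inequality and the finiteness of the norm of a difference. *)
Let Lnorm2_triangle (p q r : X -> R) : measurable_fun setT p ->
  measurable_fun setT q -> measurable_fun setT r ->
  (forall x, 0 <= p x <= q x + r x) ->
  ('N[mu]_2%:E[EFin \o p] <= 'N[mu]_2%:E[EFin \o q] + 'N[mu]_2%:E[EFin \o r])%E.
Proof.
move=> mp mq mr pqr.
apply: le_trans (minkowski_EFin mu mq mr _); last by rewrite ler1n.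
rewrite !Lnorm2E; apply: gt0_ler_poweR.
- by rewrite invr_ge0.
- by rewrite in_itv/= leey andbT; apply: integral_ge0 => x _; rewrite lee_fin sqr_ge0.
- by rewrite in_itv/= leey andbT; apply: integral_ge0 => x _; rewrite lee_fin sqr_ge0.
apply: ge0_le_integral => //.
- by move=> x _; rewrite lee_fin sqr_ge0.
- by apply/measurable_EFinP/measurable_funX.
- by apply/measurable_EFinP/measurable_funX/measurable_funD.
move=> x _; have /andP[p0 pq] := pqr x.
by rewrite lee_fin /= lerXn2r ?nnegrE// (le_trans p0).
Qed.

Let L2_norm_sub_triangle f g k :
  (L2_norm mu (fun x => (f x - k x)%R) <=
   L2_norm mu (fun x => (f x - g x)%R) + L2_norm mu (fun x => (g x - k x)%R))%E.
Proof.
apply: Lnorm2_triangle => //; try exact: measurable_normc_sub.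
move=> x; rewrite normc_ge0 /=.
have -> : f x - k x = (f x - g x) + (g x - k x) by rewrite addrA subrK.
exact: normc_triangle.
Qed.

Let L2_norm_sub_fin f g : (L2_norm mu (fun x => (f x - g x)%R) < +oo)%E.
Proof.
apply: le_lt_trans (_ : _ <= L2_norm mu f + L2_norm mu g)%E _; last first.
  by rewrite lte_add_pinfty ?L2fun_fin.
apply: Lnorm2_triangle.
- exact: measurable_normc_sub.
- by apply: measurable_normc; [exact: L2fun_Re|exact: L2fun_Im].
- by apply: measurable_normc; [exact: L2fun_Re|exact: L2fun_Im].
by move=> x; rewrite normc_ge0 /= -(normc_opp (g x)) normc_triangle.
Qed.

Lemma L2_distC u v : L2_dist u v = L2_dist v u.
Proof.
rewrite /L2_dist !L2_normE; congr fine; congr (_ `^ _)%E.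
by apply: eq_integral => x _; rewrite normc_subC.
Qed.

Lemma L2_dist_triangle v u w : L2_dist u w <= L2_dist u v + L2_dist v w.
Proof.
have fin f g : L2_norm mu (fun x => f x - g x) \is a fin_num.
  by rewrite ge0_fin_numE ?L2_norm_sub_fin//; exact: Lnorm_ge0.
by rewrite /L2_dist -fineD// fine_le// ?fin_numD ?fin//; exact: L2_norm_sub_triangle.
Qed.

Context (G : zmodType) (a : iso_action G mu).

Let orbit_dist_has_lbound u v : has_lbound [set L2_dist (L2_act a g u) v | g in setT].
Proof. by exists 0 => _ [g _ <-]; apply: fine_ge0; exact: Lnorm_ge0. Qed.

(** For each g, going from g u to v through g u' and v' costs the two extra distances, because g
    acts isometrically. This makes the orbit distance continuous. *)
Lemma L2_orbit_dist_le u v u' v' :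
  L2_orbit_dist (L2_orbit a u) (L2_orbit a v) <=
  L2_orbit_dist (L2_orbit a u') (L2_orbit a v') + (L2_dist u u' + L2_dist v v').
Proof.
rewrite -lerBlDr !L2_orbit_distE; apply: lb_le_inf.
  by exists (L2_dist (L2_act a 0 u') v'), 0.
move=> _ [g _ <-]; rewrite lerBlDr.
apply: (@le_trans _ _ (L2_dist (L2_act a g u) v)).
  by apply: ge_inf; [exact: orbit_dist_has_lbound|exists g].
apply: (le_trans (L2_dist_triangle (L2_act a g u') _ _)).
rewrite L2_act_isometry addrCA lerD2l.
by apply: (le_trans (L2_dist_triangle v' _ _)); rewrite (L2_distC v).
Qed.

End L2_metric.

(** * Truncation in l2(Z) *)

Section integers.
Context (R : realType).
Implicit Type v : L2fun (counting_int R).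

Lemma measurable_int_set (A : set int) : measurable A.
Proof. by []. Qed.

Lemma counting_int1 (x : int) : counting_int R [set x] = 1%E.
Proof.
rewrite /counting_int /= /counting asboolT; last exact: finite_set1.
by rewrite fset_set1 finmap.cardfs1.
Qed.

Lemma counting_int1_fin (x : int) : (counting_int R [set x] < +oo)%E.
Proof. by rewrite counting_int1 ltry. Qed.

(** An overlap of translates of {0} forces g + s = 0, so g determines s. *)
Lemma int_separated m : separated_translates (int_translation R) (1 : int) [set 0] m.
Proof.
move=> g s t _ _ [x [/= + x0]] [y [/= + y0]]; rewrite x0 y0 !intz; lia.
Qed.

(** The restriction of v to [-n, n], presented as a sum of translates of {0} so that the orbit
    distance formula also applies on Z. *)
Definition truncation (n : nat) v : L2fun (counting_int R) :=
  @translate_sum R int _ int (counting_int R) (int_translation R) 1 [set 0]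
    (measurable_int_set _) (counting_int1_fin 0) n.*2.+1 n
    (fun i => v (i%:Z - n%:Z)).

Lemma truncationE n v x :
  truncation n v x = if `|x| <= n%:Z then v x else 0.
Proof.
rewrite /truncation /translate_sum /= counting_int1 /= sqrtr1 invr1.
have tE (i : 'I_n.*2.+1) : \1_(translate (int_translation R) 1 [set 0] n i%:Z) x =
    (x == i%:Z - n%:Z)%:R :> R.
  rewrite indicE; congr (_%:R); congr nat_of_bool; apply/idP/eqP.
    by rewrite inE /translate /= intz; lia.
  by move=> ->; rewrite inE /translate /= intz; lia.
rewrite /step /real_step; case: ifPn => xn; last first.
  by congr Complex; rewrite big1// => i _; rewrite tE;
    case: eqP => [e|_]; rewrite ?mulr0//; have := ltn_ord i; lia.
pose i0 := absz (x + n%:Z); have i0P : (i0 < n.*2.+1)%N by rewrite /i0; lia.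
have xi0 : i0%:Z - n%:Z = x by rewrite /i0; lia.
have sumE (F : 'I_n.*2.+1 -> R) : \sum_i F i *
    \1_(translate (int_translation R) 1 [set 0] n i%:Z) x = F (Ordinal i0P).
  rewrite (bigD1 (Ordinal i0P))// tE xi0 eqxx mulr1 big1 ?Monoid.mulm1//.
  move=> i /andP[_ ii0].
  rewrite tE; case: eqP => [e|_]; rewrite ?mulr0//.
  by case/eqP: ii0; apply/val_inj => /=; rewrite /i0; lia.
rewrite !sumE /= xi0; case: (v x) => p q /=.
by rewrite !mul0r !mul1r subr0 addr0.
Qed.

(** Dominated convergence with bound |v|^2: at each x the integrand vanishes once n >= |x|. *)
Lemma truncation_cvg v :
  L2_dist (\pi_(L2 (counting_int R))%qT (truncation n v)) (\pi_(L2 (counting_int R))%qT v)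
    @[n --> \oo] --> (0 : R).
Proof.
pose f n x : \bar R := ((Normc.normc (truncation n v x - v x) ^+ 2)%:E)%E.
pose g x : \bar R := ((Normc.normc (v x) ^+ 2)%:E)%E.
have fE n x : f n x = if `|x| <= n%:Z then 0%E else g x.
  rewrite /f /g truncationE; case: ifPn => _; last by rewrite sub0r normcN.
  by rewrite subrr /= !expr0n /= addr0 sqrtr0 expr0n.
have g_ge0 x : (0 <= g x)%E by rewrite lee_fin sqr_ge0.
have ig : (counting_int R).-integrable setT g.
  apply/integrableP; split => //.
  under eq_integral do rewrite gee0_abs//.
  have := L2fun_fin v; rewrite L2_normE; rewrite !ltey; apply: contra_neq.
  by apply: eqy_poweR; rewrite invr_gt0.
have [] := @dominated_convergence _ _ R (counting_int R) setT measurableT f (cst 0%E) g.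
- by [].
- by [].
- apply: aeW => x _; apply: cvg_near_cst; exists `|x|%N => // n /= xn.
  by rewrite fE ifT//; lia.
- exact: ig.
- apply: aeW => x n _; rewrite fE; case: ifPn => _; first by rewrite abse0.
  by rewrite gee0_abs.
move=> _ _; rewrite integral0.
move=> /fine_cvg /= fcvg.
rewrite (_ : (fun n => _) = fun n => Num.sqrt (fine (\int[counting_int R]_x f n x)%E)).
  rewrite -sqrtr0; apply: continuous_cvg; first exact: sqrt_continuous.
  exact: fcvg.
apply/funext => n; rewrite L2_dist_pi L2_normE fine_poweR powR12_sqrt//.
by rewrite fine_ge0// integral_ge0// => x _; rewrite lee_fin sqr_ge0.
Qed.

End integers.

(** * Transfer to X_n and passage to the limit *)

(** The coefficients of the truncation are used on translates of B in X and of {0} in Z; equal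
    coefficients give equal correlations. The 2k + 1 translates are separated as soon as 2(2k + 1) <
    n. *)
Lemma truncation_embedding (R : realType) d (X : measurableType d)
    (mu : {measure set X -> \bar R}) (G : topologicalZmodType)
    (haar : {measure set (borelType G) -> \bar R}) (act : iso_action G mu)
    (Omega : nonempty_set X)
    (nu : {sigma_finite_measure set (subset_space Omega) -> \bar R}) (n k : nat) :
  lca_group G -> @second_countable G -> haar_measure haar ->
  has_discrete_cyclic_subgroup G n -> nu setT != 0%E ->
  measure_iso (haar \x nu)%E mu
    (fun p : borelType G * subset_space Omega => act p.1 (subset_incl p.2)) ->
  (k.*2.+1.*2 < n)%N ->
  exists Phi : L2fun (counting_int R) -> L2_orbit_space act, forall v w,
    L2_orbit_dist (Phi v) (Phi w) =
    L2_orbit_dist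
      (L2_orbit (int_translation R) (\pi_(L2 (counting_int R))%qT (truncation k v)))
      (L2_orbit (int_translation R) (\pi_(L2 (counting_int R))%qT (truncation k w))).
Proof.
move=> lG sG hP cG nu0 param kn.
have [h [B [mB B0 Bfin sep]]] := exists_separated lG sG hP cG nu0 param kn.
pose S v := @translate_sum R G d X mu act h B mB Bfin k.*2.+1 k
  (fun i : 'I_k.*2.+1 => (v : L2fun (counting_int R)) (i%:Z - k%:Z)).
exists (fun v => L2_orbit act (\pi_(L2 mu)%qT (S v))) => v w.
rewrite /S L2_orbit_dist_translate_sum// /truncation L2_orbit_dist_translate_sum//.
- by rewrite counting_int1.
- exact: int_separated.
Qed.

Lemma L2_orbit_surj (R : realType) d (X : measurableType d)
    (mu : {measure set X -> \bar R}) (G : zmodType) (a : iso_action G mu)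
    (x : L2_orbit_space a) : exists v : L2fun mu, x = L2_orbit a (\pi_(L2 mu)%qT v).
Proof.
have [u _ ux] : [set act_orbit (L2_act a) u | u in setT] (val x).
  exact: set_mem (valP x).
by exists (repr u); apply: val_inj; rewrite /= reprK -ux.
Qed.

Lemma L2_orbit_dist_ge0 (R : realType) d (X : measurableType d)
    (mu : {measure set X -> \bar R}) (G : zmodType) (a : iso_action G mu)
    (x y : L2_orbit_space a) : 0 <= L2_orbit_dist x y.
Proof.
have [v ->] := L2_orbit_surj x; have [w ->] := L2_orbit_surj y.
rewrite L2_orbit_distE; apply: lb_le_inf; first by eexists; exists 0.
by move=> _ [g _ <-]; apply: fine_ge0; exact: Lnorm_ge0.
Qed.

Lemma truncation_dist_cvg (R : realType) (v w : L2fun (counting_int R)) :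
  let orb u := L2_orbit (int_translation R) (\pi_(L2 (counting_int R))%qT u) in
  L2_orbit_dist (orb (truncation k v)) (orb (truncation k w)) @[k --> \oo] -->
    L2_orbit_dist (orb v) (orb w).
Proof.
move=> orb; pose e k u : R :=
  L2_dist (\pi_(L2 (counting_int R))%qT (truncation k u))
    (\pi_(L2 (counting_int R))%qT u).
have e0 : (e k v + e k w) @[k --> \oo] --> (0 : R).
  by rewrite -[0]addr0; apply: cvgD; exact: truncation_cvg.
apply: (@squeeze_cvgr _ _ _ _
  (fun k => L2_orbit_dist (orb v) (orb w) - (e k v + e k w))
  (fun k => L2_orbit_dist (orb v) (orb w) + (e k v + e k w))).
- apply: filterE => k; rewrite lerBlDr /e L2_orbit_dist_le andbT.
  by rewrite (L2_distC _ (\pi_(L2 (counting_int R))%qT v))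
    (L2_distC _ (\pi_(L2 (counting_int R))%qT w)) L2_orbit_dist_le.
- by rewrite -[X in _ --> X]subr0; apply: cvgB => //; exact: cvg_cst.
- by rewrite -[X in _ --> X]addr0; apply: cvgD => //; exact: cvg_cst.
Qed.

(** If the limit inferior is below c, then so is every tail infimum, and u takes values below c at
    arbitrarily large indices. Finally c decreases to the limit inferior. *)
Lemma le_limn_einf (R : realType) (u : (\bar R)^nat) (x : \bar R) :
  (forall c : R, (forall N, exists2 n, (N <= n)%N & (u n < c%:E)%E) -> (x <= c%:E)%E) ->
  (x <= limn_einf u)%E.
Proof.
move=> xP; rewrite limn_einf_lim.
have ltc c : (limn (einfs u) < c%:E)%E -> (x <= c%:E)%E.
  move=> uc; apply: xP => N.
  have : (einfs u N < c%:E)%E.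
    apply: le_lt_trans uc; rewrite (cvg_lim _ (@cvg_einfs_sup _ u))//.
    by apply: ereal_sup_ubound; exists N.
  by move=> /ereal_inf_lt[_ [n /= Nn <-] unc]; exists n.
case: (limn (einfs u)) ltc => [r| |] ltc.
- apply/lee_addgt0Pr => e e0; rewrite -EFinD; apply: ltc.
  by rewrite lte_fin ltrDl.
- exact: leey.
- case: x {xP} ltc => [r| |] // ltc.
    by have := ltc (r - 1)%R (ltNyr _); rewrite lee_fin lerBrDr gerDl ler10.
  by have := ltc 0%R (ltNyr _).
Qed.

Theorem theorem44 (R : realType)
    (d : nat -> measure_display)
    (X : forall n, measurableType (d n))
    (mu : forall n, {measure set (X n) -> \bar R})
    (G : nat -> topologicalZmodType)
    (haar : forall n, {measure set (borelType (G n)) -> \bar R})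
    (act : forall n, iso_action (G n) (mu n))
    (Omega : forall n, nonempty_set (X n))
    (nu : forall n, {sigma_finite_measure set (subset_space (Omega n)) -> \bar R})
    (G_lca : forall n, lca_group (G n))
    (G_second_countable : forall n, @second_countable (G n))
    (haarP : forall n, haar_measure (haar n))
    (act_is_free : forall n, act_free (act n) 0)
    (G_cyclic : forall n, has_discrete_cyclic_subgroup (G n) n)
    (Omega_measurable : forall n, measurable (Omega n : set (X n)))
    (Omega_fundamental : forall n, fundamental_domain (act n) (Omega n))
    (nu_neq0 : forall n, nu n setT != 0%E)
    (nu_separable : forall n, L2_separable (nu n))
    (param_iso : forall n,
      measure_iso (haar n \x nu n)%E (mu n)
        (fun p : borelType (G n) * subset_space (Omega n) =>
           act n p.1 (subset_incl p.2))) :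
  (L2_quotient_distortion (int_translation R) <=
   limn_einf (fun n => L2_quotient_distortion (act n)))%E.
Proof.
apply: le_limn_einf => c uc.
(* The bound 4k + 3 makes the chosen index exceed 2(2k + 1), as the k-th truncation demands. *)
have [nk nkP] := boolp.choice (fun k => let: ex_intro2 n h1 h2 := uc k.*2.+1.*2.+1 in
  ex_intro (fun n => (k.*2.+1.*2 < n)%N /\ _) n (conj h1 h2)).
have emb k := truncation_embedding (G_lca (nk k)) (@G_second_countable (nk k))
  (haarP (nk k)) (G_cyclic (nk k)) (nu_neq0 (nk k)) (param_iso (nk k)) (nkP k).1.
pose Phi k := projT1 (cid (emb k)).
(* The truncation depends on the function chosen in each orbit, but the limit of the truncated
   distances is the distance of the orbits. *)
have [rep repP] := boolp.choice
  (@L2_orbit_surj R _ int (counting_int R) int (int_translation R)).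
(* The infimum defining the distortion need not be attained; strict inequality supplies an embedding
   with some c' < c, weakened to c below. *)
have lt_c k : exists2 c' : R, c' < c & 1 <= c' /\
    exists (H : completeNormedModType R) (f : L2_orbit_space (act (nk k)) -> H) (a : R),
      [/\ is_hilbert H, 0 < a & forall x y,
        a * L2_orbit_dist x y <= `|f x - f y| <= c' * a * L2_orbit_dist x y].
  have [_ [c' c'P <-] c'c] := ereal_inf_lt (nkP k).2.
  by exists c'.
(* The base point is the orbit of the zero function, an empty sum of translates. *)
pose x0 := L2_orbit (int_translation R) (\pi_(L2 (counting_int R))%qT
  (@translate_sum R int _ int (counting_int R) (int_translation R) 1 [set 0]
    (measurable_int_set _) (counting_int1_fin R 0) 0 0 (fun=> 0))).
apply: (@distortion_limit R _ _ c _ (fun k => @L2_orbit_dist _ _ _ _ _ (act (nk k)))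
  (fun k x => Phi k (rep x)) x0).
- by have [c' c'c [c1 _]] := lt_c 0%N; exact: le_trans c1 (ltW c'c).
- move=> k; have [c' c'c [_ [H [f [a [hH a0 fP]]]]]] := lt_c k.
  exists H, f, a; split => // x y; have /andP[-> fxy] := fP x y.
  rewrite (le_trans fxy)// -!mulrA ler_wpM2r ?(ltW c'c)// mulr_ge0 ?(ltW a0)//.
  exact: L2_orbit_dist_ge0.
move=> x y; rewrite [x in L2_orbit_dist x y]repP [y in L2_orbit_dist _ y]repP.
under eq_fun do rewrite (projT2 (cid (emb _))).
exact: truncation_dist_cvg.
Qed.
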